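(* Let $n\ge 2$, $N\ge1$, $\tau=2k-1+\epsilon$ with $k\in\mathbb{N}$, $\epsilon\in\{0,1\}$, and assume there exists a spherical $\tau$-design of cardinality $N$ on $\mathbb{S}^{n-1}$. Let $h$ be a potential that is continuous on $[-1,1]$, finite on $(-1,1)$, and satisfies $h^{(\tau+1)}(t)\le 0$ for all $t\in(-1,1)$. Define nodes as follows: if $\epsilon=0$, let $\alpha_0=-1$, let $\alpha_1<\dots<\alpha_{k-1}$ be the roots of $P_{k-1}^{(1,1)}$, and $\alpha_k=1$; if $\epsilon=1$, let $\alpha_1<\dots<\alpha_k$ be the roots of $P_k^{(1,0)}$ and $\alpha_{k+1}=1$. Let $\ell_i$ be the Lagrange basic polynomials for the nodes $\{\alpha_i\}_{i=\epsilon}^{k+\epsilon}$ and $\rho_i:=\gamma_n\int_{-1}^1\ell_i(t)(1-t^2)^{(n-3)/2}dt$. Then the $\rho_i$ are positive with $\sum_{i=\epsilon}^{k+\epsilon}\rho_i=1$, and $$\mathcal{Q}^{(h)}(n,\tau,N)\ge N\sum_{i=\epsilon}^{k+\epsilon}\rho_i h(\alpha_i),\qquad \mathcal{R}^{(h)}(n,\tau,N)\ge N\sum_{i=\epsilon}^{k+\epsilon}\rho_i h(\alpha_i).$$ Moreover, the first bound is the best obtainable from lower admissible polynomials: $\max_{f\in\mathcal{L}(n,\tau,h)}Nf_0=N\sum_{i=\epsilon}^{k+\epsilon}\rho_i h(\alpha_i)$.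
   Context: $\mathbb{S}^{n-1}\subset\mathbb{R}^n$ is the unit sphere; a spherical code is a finite set of distinct points on it. For a potential $h:[-1,1]\to(-\infty,+\infty]$ and a code $C$, $U_h(x,C):=\sum_{y\in C}h(x\cdot y)$; $\mathcal{Q}_h(C):=\inf_{x\in\mathbb{S}^{n-1}}U_h(x,C)$, $\mathcal{R}_h(C):=\sup_{x\in\mathbb{S}^{n-1}}U_h(x,C)$. A spherical $\tau$-design is a finite $C\subset\mathbb{S}^{n-1}$ on which the average of every polynomial of degree $\le\tau$ equals its average over the sphere. $\mathcal{Q}^{(h)}(n,\tau,N):=\sup\{\mathcal{Q}_h(C):|C|=N,\ C\text{ a }\tau\text{-design}\}$, $\mathcal{R}^{(h)}(n,\tau,N):=\inf\{\mathcal{R}_h(C):|C|=N,\ C\text{ a }\tau\text{-design}\}$. $\gamma_n$ is such that $\gamma_n\int_{-1}^1(1-t^2)^{(n-3)/2}dt=1$. For $a,b\in\{0,1\}$, $P_k^{(a,b)}$ is the Jacobi polynomial of degree $k$ with parameters $\alpha=a+(n-3)/2$, $\beta=b+(n-3)/2$, normalized by $P_k^{(a,b)}(1)=1$ ($P_0^{(a,b)}\equiv1$ has no roots). For a polynomial $f$, $f_0=\gamma_n\int_{-1}^1f(t)(1-t^2)^{(n-3)/2}dt$. $\mathcal{L}(n,\tau,h)$ is the set of real polynomials $f$ with $\deg f\le\tau$ and $f\le h$ on $[-1,1]$. *)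

(* Defs.v *)
From HB Require Import structures.
From mathcomp Require Import all_boot all_order all_algebra.
From mathcomp Require mpoly.
From mathcomp Require Import all_classical all_reals all_analysis.
Unset Printing Implicit Defensive.
Import Order.TTheory GRing.Theory Num.Theory.
Local Open Scope classical_set_scope.
Local Open Scope ring_scope.

Section Defs.
Variable R : realType.

Definition wexp (n : nat) : R := (n%:R - 3) / 2.

Definition wint (n : nat) (f : R -> R) : R :=
  fine (\int[@lebesgue_measure R]_(t in `[(-1)%R, 1%R]) (f t * (1 - t ^+ 2) `^ (wexp n))%:E)%E.

Definition gam (n : nat) : R := (wint n (fun=> 1))^-1.

Definition f0coef (n : nat) (f : {poly R}) : R := gam n * wint n (fun t => f.[t]).

(* ---------- Jacobi polynomials P_k^{(a,b)}, alpha = a+(n-3)/2, beta = b+(n-3)/2,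
   normalized by P(1) = 1.  Explicit formula (DLMF 18.5.8):
   P_k^{(al,be)}(x) = sum_l C(k+al, k-l) C(k+be, l) ((x-1)/2)^l ((x+1)/2)^(k-l),
   whose value at 1 is C(k+al,k). ---------- *)
Definition gbinom (x : R) (m : nat) : R :=
  (\prod_(i < m) (x - i%:R)) / (m`!)%:R.

Definition jacobi_std (k : nat) (al be : R) : {poly R} :=
  \sum_(l < k.+1)
     (gbinom (k%:R + al) (k - l) * gbinom (k%:R + be) l) *:
       ((2^-1 *: ('X - 1)) ^+ l * (2^-1 *: ('X + 1)) ^+ (k - l)).

Definition jacobi (n k a b : nat) : {poly R} :=
  (gbinom (k%:R + (a%:R + wexp n)) k)^-1 *: jacobi_std k (a%:R + wexp n) (b%:R + wexp n).

Definition incr_on (al : nat -> R) (lo hi : nat) : Prop :=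
  forall i j, (lo <= i)%N -> (i < j)%N -> (j <= hi)%N -> al i < al j.

Definition nodes (n k : nat) (eps : bool) (al : nat -> R) : Prop :=
  if eps then
    [/\ al k.+1 = 1, incr_on al 1 k &
        forall t, root (jacobi n k 1 0) t <-> exists2 i, (1 <= i <= k)%N & t = al i]
  else
    [/\ al 0%N = -1, al k = 1, incr_on al 1 k.-1 &
        forall t, root (jacobi n k.-1 1 1) t <-> exists2 i, (1 <= i <= k.-1)%N & t = al i].

Definition idx (k : nat) (eps : bool) : seq nat := iota eps k.+1.

Definition lagr (al : nat -> R) (I : seq nat) (i : nat) : {poly R} :=
  \prod_(j <- I | j != i) ((al i - al j)^-1 *: ('X - (al j)%:P)).

Definition dotp (n : nat) (x y : 'rV[R]_n) : R := \sum_(i < n) x 0 i * y 0 i.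
Definition sphere (n : nat) : set 'rV[R]_n := [set x | dotp n x x = 1].

(* Normalized (probability) surface measure on S^m ⊂ R^(m+1), defined by the
   standard slicing recursion: S^0 = {1,-1} with mass 1/2 each, and
   \int_{S^{m+1}} f = gamma_{m+2} \int_{-1}^1 (1-t^2)^{(m-1)/2}
                         \int_{S^m} f(t, sqrt(1-t^2) y) dsigma(y) dt.
   Points are given as coordinate lists. *)
Fixpoint savg (m : nat) (f : seq R -> R) : R :=
  match m with
  | 0%N => (f [:: 1] + f [:: -1]) / 2
  | m'.+1 => gam m'.+2 * wint m'.+2
      (fun t => savg m' (fun y => f (t :: map (fun c => Num.sqrt (1 - t ^+ 2) * c) y)))
  end.

Definition sphere_avg (n : nat) (F : 'rV[R]_n -> R) : R :=
  savg n.-1 (fun s => F (\row_(i < n) nth 0 s i)).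

Definition peval (n : nat) (p : mpoly.mpoly n R) (x : 'rV[R]_n) : R :=
  mpoly.meval (fun i => x 0 i) p.

Definition code (n N : nat) (C : seq 'rV[R]_n) : Prop :=
  [/\ uniq C, size C = N & forall x, x \in C -> sphere n x].

Definition design (n tau N : nat) (C : seq 'rV[R]_n) : Prop :=
  code n N C /\
  forall p : mpoly.mpoly n R, (forall m : mpoly.multinom n, mpoly.mcoeff m p <> 0 -> (mpoly.mdeg m <= tau)%N) ->
    (\sum_(y <- C) peval n p y) / (size C)%:R = sphere_avg n (peval n p).

Definition Uh (n : nat) (h : R -> \bar R) (x : 'rV[R]_n) (C : seq 'rV[R]_n) : \bar R :=
  (\sum_(y <- C) h (dotp n x y))%E.

Definition Qh (n : nat) (h : R -> \bar R) (C : seq 'rV[R]_n) : \bar R :=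
  ereal_inf [set Uh n h x C | x in sphere n].

Definition Rh (n : nat) (h : R -> \bar R) (C : seq 'rV[R]_n) : \bar R :=
  ereal_sup [set Uh n h x C | x in sphere n].

Definition Qopt (n tau N : nat) (h : R -> \bar R) : \bar R :=
  ereal_sup [set Qh n h C | C in [set C | design n tau N C]].

Definition Ropt (n tau N : nat) (h : R -> \bar R) : \bar R :=
  ereal_inf [set Rh n h C | C in [set C | design n tau N C]].

Definition Ladm (tau : nat) (h : R -> \bar R) : set {poly R} :=
  [set f : {poly R} | (size f <= tau.+1)%N /\
           forall t, -1 <= t <= 1 -> ((f.[t])%:E <= h t)%E].

Definition potential_ok (tau : nat) (h : R -> \bar R) : Prop :=
  [/\ forall t, -1 <= t <= 1 -> h t != -oo%E,
      forall t, -1 < t < 1 -> h t \is a fin_num,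
      {within `[(-1)%R, 1%R], continuous h},
      (forall j t, (j <= tau)%N -> -1 < t < 1 ->
         derivable (derive1n j (fine \o h)) t 1) &
      forall t, -1 < t < 1 -> derive1n tau.+1 (fine \o h) t <= 0].

End Defs.

Arguments wint {R}. Arguments f0coef {R}. Arguments jacobi {R}. Arguments nodes {R}.
Arguments lagr {R}. Arguments design {R}. Arguments Qopt {R}. Arguments Ropt {R}.
Arguments Ladm {R}. Arguments potential_ok {R}. Arguments dotp {R}. Arguments sphere {R}.
Arguments code {R}. Arguments Uh {R}. Arguments Qh {R}. Arguments Rh {R}.
Arguments sphere_avg {R}. Arguments peval {R}. Arguments savg {R}.

(* Main.v *)
(* Let L be the mean of a polynomial against the weight (1-t^2)^((n-3)/2).  Integration by
   parts gives L((1-X^2) p' - (n-1) X p) = 0, and with the Rodrigues formula this makes the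
   Jacobi polynomial whose roots are the interior nodes orthogonal, for the weight
   multiplied by (1-t) or (1-t^2), to all polynomials of smaller degree.  Hence the
   quadrature at the nodes is exact up to degree tau, and its weights are positive because
   each of them is, up to a positive factor, L of a nonnegative polynomial of degree at most
   tau vanishing at the other nodes.

   Let f interpolate h at the nodes, twice at the interior ones.  The error h - f is
   h^(tau+1)(c)/(tau+1)! times a polynomial that is nonpositive on [-1,1], so f <= h there,
   and L f is the claimed sum; h is finite at the end nodes by the same formula for other
   nodes.  For every admissible q, quadrature gives L q = sum rho_i q(alpha_i)
   <= sum rho_i h(alpha_i).  For a design C and a point x of the sphere,
   U_h(x,C) >= sum_y f(x.y) = N L f; this needs the mean of f(x.y) over the sphere to be
   L f for every x, although the slicing recursion singles out the first coordinate.  By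
   induction on the dimension, the mean of (x.y)^d depends on x only through |x|. *)
Require Import Defs.
From HB Require Import structures.
From mathcomp Require Import all_boot all_order all_algebra.
From mathcomp Require mpoly.
From mathcomp Require Import all_classical all_reals all_analysis measurable_realfun.
From mathcomp Require Import ring lra zify.
Import Order.TTheory GRing.Theory Num.Theory.
Import numFieldNormedType.Exports.
Import (canonicals, coercions) mpoly.
Local Open Scope classical_set_scope.
Local Open Scope ring_scope.

Set Implicit Arguments.
Unset Strict Implicit.

(** * Integration against the weight *)

(* The integrand may be unbounded at both ends, as the weight of n = 2 is. *)
Lemma ge0_ftc_itvoo (R : realType) (F f : R -> R) (a b : R) : a < b ->
  continuous F ->
  (forall x, a < x < b -> is_derive x 1 F (f x)) ->
  (forall x, a < x < b -> {for x, continuous f}) ->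
  (forall x, a < x < b -> 0 <= f x) ->
  (\int[@lebesgue_measure R]_(x in `]a, b[) (f x)%:E = (F b - F a)%:E)%E.
Proof.
move=> ab cF dF cf f0.
(* The compact intervals [E i] exhaust the open one; [i.+2] keeps [e i] below half the length, so
   that no [E i] is degenerate. The fundamental theorem holds on each of them, and monotone
   convergence passes to the union. *)
pose e (i : nat) := (b - a) / 2 * i.+2%:R^-1.
have e0 i : 0 < e i by rewrite mulr_gt0 ?divr_gt0 ?subr_gt0 ?invr_gt0 ?ltr0n.
have eh i : e i < (b - a) / 2.
  by rewrite gtr_pMr ?divr_gt0 ?subr_gt0// invf_lt1 ?ltr0n// ltr1n.
have ecvg : e @ \oo --> (0 : R).
  rewrite -[X in _ --> X](mulr0 ((b - a) / 2)).
  apply: cvgM; first exact: cvg_cst.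
  by have := @cvg_harmonic R; rewrite -cvg_shiftS.
pose E i : set R := `[a + e i, b - e i]%classic.
have Esub i : E i `<=` `]a, b[%classic.
  move=> x; rewrite /E /= !in_itv/= => /andP[h1 h2]; have := e0 i; lra.
have EU : \bigcup_i E i = `]a, b[%classic.
  apply/seteqP; split=> [x [i _ /Esub//]|x]; rewrite /= in_itv/= => /andP[ax xb].
  have d0 : 0 < Num.min (x - a) (b - x) by rewrite lt_min !subr_gt0 ax.
  have [i _ ei] : \forall i \near \oo, e i < Num.min (x - a) (b - x).
    move/cvgrPdist_lt : ecvg => /(_ _ d0).
    by apply: filterS => i; rewrite sub0r normrN gtr0_norm.
  exists i => //; rewrite /E /= in_itv/=.
  by have := ei i (leqnn _); rewrite lt_min => /andP[]; lra.
have Ei i : (\int[@lebesgue_measure R]_(x in E i) (f x)%:E = (F (b - e i) - F (a + e i))%:E)%E.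
  have lei : a + e i < b - e i by have := eh i; lra.
  rewrite (@continuous_FTC2 _ f F)//.
  - apply/continuous_in_subspaceT => x; rewrite inE => /Esub.
    by rewrite /= in_itv/=; exact: cf.
  - split.
    + move=> x xE; have : x \in `]a, b[.
        by move: xE; rewrite !in_itv/= => /andP[]; have := e0 i; lra.
      by rewrite in_itv/= => /dF [].
    + exact/cvg_at_right_filter/cF.
    + exact/cvg_at_left_filter/cF.
  - move=> x xE; have : x \in `]a, b[.
      by move: xE; rewrite !in_itv/= => /andP[]; have := e0 i; lra.
    by rewrite in_itv/= derive1E => /dF [].
rewrite -EU.
have mf i : measurable_fun (E i) (EFin \o f).
  apply/measurable_EFinP; apply: (measurable_funS _ (Esub i)) => //.
  apply: open_continuous_measurable_fun; first exact: interval_open.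
  by move=> x; rewrite inE /= in_itv/=; exact: cf.
have ndE : nondecreasing_seq E.
  apply/nondecreasing_seqP => i; apply/subsetPset => x; rewrite /E /= !in_itv/=.
  have : e i.+1 <= e i by rewrite ler_pM2l ?divr_gt0 ?subr_gt0// lef_pV2 ?posrE ?ltr0n// ler_nat.
  move: (e i.+1) (e i) => u v; lra.
have cv : (fun i => (F (b - e i) - F (a + e i))%:E) @ \oo -->
    (\int[@lebesgue_measure R]_(x in \bigcup_i E i) (f x)%:E)%E.
  under eq_fun do rewrite -Ei.
  apply: ge0_nondecreasing_set_cvg_integral => //.
    by move=> i; exact: measurable_itv.
  by move=> i x /Esub; rewrite /= in_itv/= lee_fin; exact: f0.
apply: (cvg_unique _ cv) => //=.
apply: cvg_EFin; first exact: nearW.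
apply: cvgB.
  apply: continuous_cvg; first exact: cF.
  rewrite -[X in _ --> X]subr0; apply: cvgB => //; exact: cvg_cst.
apply: continuous_cvg; first exact: cF.
rewrite -[X in _ --> X]addr0; apply: cvgD => //; exact: cvg_cst.
Qed.

Section GegenbauerWeight.
Variable R : realType.
Local Notation mu := (@lebesgue_measure R).
Implicit Types (n : nat) (p q : {poly R}).
Local Notation I1 := (`]((-1)%R : R), (1%R : R)[%classic).

Definition half_circle (t : R) : R := Num.sqrt (1 - t ^+ 2).
(* Integrable, and above (1 - t^2)^((n-3)/2) for every n >= 2; it is the derivative
   of edge_primitive. *)
Definition edge_majorant (t : R) : R := (Num.sqrt (1 + t))^-1 + (Num.sqrt (1 - t))^-1.
Definition edge_primitive (t : R) : R := 2 * (Num.sqrt (1 + t) - Num.sqrt (1 - t)).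

Lemma one_minus_sqr_gt0 (t : R) : -1 < t < 1 -> 0 < 1 - t ^+ 2.
Proof. by move=> ?; nra. Qed.

Lemma half_circle_gt0 (t : R) : -1 < t < 1 -> 0 < half_circle t.
Proof. by move=> /one_minus_sqr_gt0; rewrite sqrtr_gt0. Qed.

Lemma continuous_half_circle : continuous half_circle.
Proof.
move=> t; apply: continuous_comp; last exact: sqrt_continuous.
apply: cvgB; first exact: cvg_cst.
exact: exprn_continuous.
Qed.

Lemma continuous_sqrt_affine (c : R) : continuous (fun t : R => Num.sqrt (1 + c * t)).
Proof.
move=> t; apply: continuous_comp; last exact: sqrt_continuous.
apply: cvgD; first exact: cvg_cst.
by apply: cvgM; [exact: cvg_cst|exact: cvg_id].
Qed.

Lemma continuous_edge_primitive : continuous edge_primitive.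
Proof.
have -> : edge_primitive = fun t => 2 * (Num.sqrt (1 + 1 * t) - Num.sqrt (1 + (-1) * t)).
  by apply/funext => t; rewrite mul1r mulN1r.
move=> t; apply: cvgM; first exact: cvg_cst.
by apply: cvgB; exact: continuous_sqrt_affine.
Qed.

Lemma continuous_edge_majorant (t : R) : -1 < t < 1 -> {for t, continuous edge_majorant}.
Proof.
move=> tI.
have -> : edge_majorant = fun t => (Num.sqrt (1 + 1 * t))^-1 + (Num.sqrt (1 + (-1) * t))^-1.
  by apply/funext => x; rewrite mul1r mulN1r.
apply: cvgD; apply: cvgV; try exact: continuous_sqrt_affine.
- by rewrite gt_eqF// sqrtr_gt0; lra.
- by rewrite /= gt_eqF// sqrtr_gt0; lra.
Qed.

Lemma is_derive_edge_primitive (t : R) : -1 < t < 1 -> is_derive t 1 edge_primitive (edge_majorant t).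
Proof.
move=> tI.
have h1 : 0 < 1 + t by lra.
have h2 : 0 < 1 - t by lra.
have d1 : is_derive t 1 (Num.sqrt \o (fun x : R => 1 + x)) ((2 * Num.sqrt (1 + t))^-1).
  apply: is_derive_eq.
    apply: is_derive1_comp; exact: is_derive1_sqrt.
  by rewrite add0r !mulr1.
have d2 : is_derive t 1 (Num.sqrt \o (fun x : R => 1 - x)) (- (2 * Num.sqrt (1 - t))^-1).
  apply: is_derive_eq.
    apply: is_derive1_comp; exact: is_derive1_sqrt.
  by rewrite add0r mul1r mulrN1.
have -> : edge_primitive = 2 \*: ((Num.sqrt \o (fun x : R => 1 + x)) - (Num.sqrt \o (fun x : R => 1 - x))) by [].
apply: is_derive_eq.
rewrite /edge_majorant opprK scalerDr /GRing.scale/= !invfM !mulrA divff ?mul1r//.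
Qed.

(** Since (n-3)/2 = ((n-1) - 2)/2, the real exponent reduces to an integer power of [half_circle],
    which [wint_ibp] can differentiate. *)
Lemma powR_wexp n (t : R) : (2 <= n)%N -> -1 < t < 1 ->
  (1 - t ^+ 2) `^ (wexp R n) = half_circle t ^+ n.-1 / (1 - t ^+ 2).
Proof.
move=> n2 tI; have t2 := one_minus_sqr_gt0 tI; have s0 := half_circle_gt0 tI.
have -> : wexp R n = 2^-1 * (n.-1%:R - 2%:R).
  rewrite /wexp mulrC; congr (_ * _).
  by case: n n2 => // n _; rewrite -natr1 /=; lra.
rewrite powRrM powR12_sqrt ?ltW// powRB ?(gt_eqF s0)//; last by apply/implyP.
by rewrite !powR_mulrn ?sqrtr_ge0// sqr_sqrtr// ltW.
Qed.

(** The worst case is n = 2, as [half_circle] is at most 1. There, with a and b the square roots of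
    1 + t and 1 - t, the weight is 1/(ab), the majorant is (a + b)/(ab), and a + b >= 1 because a^2
    + b^2 = 2. *)
Lemma powR_wexp_le n (t : R) : (2 <= n)%N -> -1 < t < 1 ->
  (1 - t ^+ 2) `^ (wexp R n) <= edge_majorant t.
Proof.
move=> n2 tI; have t2 := one_minus_sqr_gt0 tI; have s0 := half_circle_gt0 tI.
rewrite powR_wexp//.
have s1 : half_circle t <= 1 by rewrite -sqrtr1 ler_sqrt// gerBl sqr_ge0.
apply: (@le_trans _ _ (half_circle t / (1 - t ^+ 2))).
  rewrite ler_pM2r ?invr_gt0//; case: n n2 => // -[//|n] _ /=.
  by rewrite exprS ger_pMr// exprn_ile1// ltW.
rewrite -{1}[1 - t ^+ 2]sqr_sqrtr; last exact: ltW.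
rewrite -/(half_circle t) expr2 invfM mulrA divff ?gt_eqF// mul1r.
have -> : half_circle t = Num.sqrt (1 + t) * Num.sqrt (1 - t).
  by rewrite -sqrtrM; [rewrite /half_circle; congr Num.sqrt; ring|lra].
have : 0 < Num.sqrt (1 + t) by rewrite sqrtr_gt0; lra.
have : 0 < Num.sqrt (1 - t) by rewrite sqrtr_gt0; lra.
have : Num.sqrt (1 + t) ^+ 2 = 1 + t by rewrite sqr_sqrtr; lra.
have : Num.sqrt (1 - t) ^+ 2 = 1 - t by rewrite sqr_sqrtr; lra.
rewrite /edge_majorant; move: (Num.sqrt (1 + t)) (Num.sqrt (1 - t)) => a b b2 a2 b0 a0.
have -> : a^-1 + b^-1 = (a + b) * (a * b)^-1 by field; rewrite !gt_eqF.
apply: ler_peMl; first by rewrite invr_ge0 mulr_ge0// ltW.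
by nra.
Qed.

Lemma integral_edge_majorant : (\int[mu]_(x in I1) (edge_majorant x)%:E = (edge_primitive 1 - edge_primitive (-1))%:E)%E.
Proof.
apply: ge0_ftc_itvoo.
- by lra.
- exact: continuous_edge_primitive.
- exact: is_derive_edge_primitive.
- exact: continuous_edge_majorant.
by move=> x _; rewrite addr_ge0// invr_ge0 sqrtr_ge0.
Qed.

Lemma integrable_edge_majorant : mu.-integrable I1 (EFin \o edge_majorant).
Proof.
apply/integrableP; split.
  apply/measurable_EFinP; apply: open_continuous_measurable_fun; first exact: interval_open.
  by move=> x; rewrite inE /= in_itv/=; exact: continuous_edge_majorant.
under eq_integral => x _.
  rewrite /= ger0_norm; last by rewrite addr_ge0// invr_ge0 sqrtr_ge0.
  over.
by rewrite integral_edge_majorant ltry.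
Qed.

Lemma integrable_edge_majorantZ (K : R) :
  mu.-integrable I1 (EFin \o (fun x => K * edge_majorant x)).
Proof.
rewrite (_ : EFin \o _ = fun x => (K%:E * (EFin \o edge_majorant) x)%E)//.
by apply: integrableZl => //; exact: integrable_edge_majorant.
Qed.

Lemma integrable_edge_dominated (f : R -> R) (K : R) :
  (forall x : R, -1 < x < 1 -> {for x, continuous f}) ->
  (forall x : R, -1 < x < 1 -> `|f x| <= K * edge_majorant x) ->
  mu.-integrable I1 (EFin \o f).
Proof.
move=> cf fK.
apply: (@le_integrable _ _ _ mu I1 _ _ (EFin \o (fun x => K * edge_majorant x))) => //.
- apply/measurable_EFinP; apply: open_continuous_measurable_fun; first exact: interval_open.
  by move=> x; rewrite inE /= in_itv/=; exact: cf.
- move=> x; rewrite /= in_itv/= => /fK h; rewrite lee_fin.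
  exact: (le_trans h (ler_norm _)).
- exact: integrable_edge_majorantZ.
Qed.

(* Adding K * edge_majorant makes the derivative nonnegative, so that ge0_ftc_itvoo
   applies. *)
Lemma integral_edge_dominated_eq0 (F f : R -> R) (K : R) : continuous F -> F 1 = F (-1) ->
  (forall x : R, -1 < x < 1 -> is_derive x 1 F (f x)) ->
  (forall x : R, -1 < x < 1 -> {for x, continuous f}) ->
  (forall x : R, -1 < x < 1 -> `|f x| <= K * edge_majorant x) ->
  \int[mu]_(x in I1) f x = 0.
Proof.
move=> cF F1 dF cf fK.
have fi := integrable_edge_dominated cf fK.
have Kvi := integrable_edge_majorantZ K.
pose G x := F x + K * edge_primitive x.
have key : (\int[mu]_(x in I1) (f x + K * edge_majorant x)%:E = (G 1 - G (-1))%:E)%E.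
  apply: ge0_ftc_itvoo.
  - by lra.
  - move=> x; apply: cvgD; first exact: cF.
    by apply: cvgM; [exact: cvg_cst|exact: continuous_edge_primitive].
  - move=> x xI; have := dF x xI; have := is_derive_edge_primitive xI => d1 d2.
    have -> : G = F + K \*: edge_primitive by [].
    exact: is_derive_eq.
  - move=> x xI; apply: cvgD; first exact: cf.
    by apply: cvgM; [exact: cvg_cst|exact: continuous_edge_majorant].
  - by move=> x /fK; rewrite ler_norml; lra.
have : \int[mu]_(x in I1) (f x + K * edge_majorant x) = G 1 - G (-1).
  by rewrite /Rintegral key.
rewrite RintegralD// RintegralZl//; last exact: integrable_edge_majorant.
have -> : \int[mu]_(x in I1) edge_majorant x = edge_primitive 1 - edge_primitive (-1).
  by rewrite /Rintegral integral_edge_majorant.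
rewrite /G F1 => /eqP; rewrite -subr_eq0 => /eqP h.
by rewrite -[RHS]h; ring.
Qed.

Lemma horner_bound (p : {poly R}) : exists2 K, 0 <= K &
  forall x : R, -1 <= x <= 1 -> `|p.[x]| <= K.
Proof.
exists (\sum_(i < size p) `|p`_i|) => [|x xI]; first by rewrite sumr_ge0.
rewrite horner_coef; apply: (le_trans (ler_norm_sum _ _ _)).
apply: ler_sum => i _; rewrite normrM ler_piMr// normrX exprn_ile1//.
by rewrite ler_norml.
Qed.

Definition weighted n (p : {poly R}) (t : R) : R := p.[t] * (1 - t ^+ 2) `^ (wexp R n).

Lemma continuous_weighted n p (t : R) : (2 <= n)%N -> -1 < t < 1 -> {for t, continuous (weighted n p)}.
Proof.
move=> n2 tI; apply: cvgM; first exact: continuous_horner.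
apply: (@continuous_comp _ _ _ (fun t : R => 1 - t ^+ 2) (fun x => x `^ wexp R n)).
  by apply: cvgB; [exact: cvg_cst|exact: exprn_continuous].
apply/differentiable_continuous/derivable1_diffP/derivable_powR.
by rewrite in_itv/= andbT one_minus_sqr_gt0.
Qed.

Lemma weighted_le_edge n p : (2 <= n)%N -> exists K, forall x : R, -1 < x < 1 -> `|weighted n p x| <= K * edge_majorant x.
Proof.
move=> n2; have [K K0 pK] := horner_bound p; exists K => x xI.
rewrite normrM ler_pM//; first by apply: pK; lra.
by rewrite ger0_norm ?powR_ge0// powR_wexp_le.
Qed.

Lemma integrable_weighted n p : (2 <= n)%N -> mu.-integrable I1 (EFin \o weighted n p).
Proof.
move=> n2; have [K pK] := weighted_le_edge p n2.
by apply: integrable_edge_dominated pK => x; exact: continuous_weighted.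
Qed.

Lemma wint_oo n p : (2 <= n)%N -> wint n (horner p) = \int[mu]_(x in I1) weighted n p x.
Proof.
move=> n2; rewrite /wint -/(weighted n p) /Rintegral; congr fine.
have mf : measurable_fun I1 (EFin \o weighted n p).
  by have /integrableP[] := integrable_weighted p n2.
rewrite -integral_itv_bndo_bndc; first by rewrite integral_itv_obnd_cbnd.
by apply/emeasurable_fun_itv_obnd_cbndP.
Qed.

Lemma wintD n p q : (2 <= n)%N ->
  wint n (horner (p + q)) = wint n (horner p) + wint n (horner q).
Proof.
move=> n2; rewrite !wint_oo// -RintegralD//; try exact: integrable_weighted.
by apply: eq_Rintegral => x _; rewrite /weighted hornerD mulrDl.
Qed.

Lemma wintZ n c p : (2 <= n)%N -> wint n (horner (c *: p)) = c * wint n (horner p).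
Proof.
move=> n2; rewrite !wint_oo// -RintegralZl//; try exact: integrable_weighted.
by apply: eq_Rintegral => x _; rewrite /weighted hornerZ mulrA.
Qed.

(** Linear factors are split off one at a time. Finiteness of the zero set makes it a null set in
    [wint_ge0_gt0]. *)
Lemma poly_roots_seq (F : fieldType) (p : {poly F}) :
  p != 0 -> exists r : seq F, forall x, root p x -> x \in r.
Proof.
have [m] := ubnP (size p); elim: m p => // m IH p pm p0.
have [[a pa]|np] := pselect (exists a, root p a); last first.
  by exists [::] => x px; case: np; exists x.
have /factor_theorem [q pE] := pa.
have q0 : q != 0 by apply: contraNneq p0 => q0; rewrite pE q0 mul0r.
have [|r rq] := IH q _ q0.
  by move: pm; rewrite pE size_Mmonic ?monicXsubC// size_XsubC addn2.
exists (a :: r) => x; rewrite pE rootM root_XsubC inE => /orP[/rq ->|->//].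
by rewrite orbT.
Qed.

(** If the integral were 0, the nonnegative integrand would vanish almost everywhere, so that ]-1,
    1[ would be covered by a null set and finitely many roots. *)
Lemma wint_ge0_gt0 n p : (2 <= n)%N -> p != 0 ->
  (forall x : R, -1 < x < 1 -> 0 <= p.[x]) -> 0 < wint n (horner p).
Proof.
move=> n2 p0 ppos; rewrite wint_oo//.
have wp0 x : I1 x -> 0 <= weighted n p x.
  by rewrite /= in_itv/= => /ppos h; rewrite mulr_ge0// powR_ge0.
rewrite lt_neqAle Rintegral_ge0// andbT eq_sym; apply/negP => /eqP int0.
have mf : measurable_fun I1 (EFin \o weighted n p).
  by have /integrableP[] := integrable_weighted p n2.
have fin : (\int[mu]_(x in I1) (weighted n p x)%:E)%E \is a fin_num.
  by apply: integrable_fin_num => //; exact: integrable_weighted.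
have [N [mN N0 sN]] : ae_eq mu I1 (EFin \o weighted n p) (cst 0%E).
  apply/ae_eq_integral_abs => //.
  transitivity (\int[mu]_(x in I1) (EFin \o weighted n p) x)%E.
    by apply: eq_integral => x; rewrite inE => /wp0 h; rewrite /= ger0_norm.
  by rewrite -[LHS]fineK//; congr (_%:E).
have [r rp] := poly_roots_seq p0.
have cr : countable [set` r] by apply: finite_set_countable; exact: finite_seq.
have mr : measurable [set` r] by apply: countable_measurable => // t; exact: measurable_set1.
have : (mu I1 = 0)%E.
  apply: (@subset_measure0 _ _ _ mu _ (N `|` [set` r])) => //.
  - exact: measurableU.
  - move=> x xI; have [xr|xr] := boolP (x \in r); [by right|left].
    apply: sN => /=; move=> /(_ xI) /= [] /eqP.
    rewrite mulf_eq0 => /orP[px|]; first by rewrite rp in xr.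
    rewrite powR_eq0 => /andP[+ _].
    by move: xI; rewrite /= in_itv/= => /one_minus_sqr_gt0 h; rewrite gt_eqF.
  - by apply: null_set_setU => //; exact: countable_lebesgue_measure0.
rewrite lebesgue_measure_itv/= lte_fin.
have -> : (-1 : R) < 1 by lra.
by move=> [] h; lra.
Qed.

(** The integrand is the derivative of (1-t^2)^((n-1)/2) p(t), which vanishes at both ends because n
    >= 2. *)
Lemma wint_ibp n (p : {poly R}) : (2 <= n)%N ->
  wint n (horner ((1 - 'X^2) * p^`() - (n.-1%:R) *: ('X * p))) = 0.
Proof.
move=> n2; rewrite wint_oo//.
set q := (X in weighted n X).
have [K qK] := weighted_le_edge q n2.
apply: (integral_edge_dominated_eq0 (F := fun t => half_circle t ^+ n.-1 * p.[t]) _ _ _ _ qK).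
- move=> x; apply: cvgM; last exact: continuous_horner.
  apply: (@continuous_comp _ _ _ half_circle (fun y => y ^+ n.-1)); first exact: continuous_half_circle.
  exact: exprn_continuous.
- by case: n n2 {q qK} => // -[//|n] _; rewrite /half_circle sqrrN expr1n subrr sqrtr0 expr0n/= !mul0r.
- move=> t tI; have st := half_circle_gt0 tI; have s2t := one_minus_sqr_gt0 tI.
  have ds : is_derive t 1 half_circle (- t / half_circle t).
    have -> : half_circle = Num.sqrt \o (fun x => 1 - x ^+ 2) by [].
    apply: is_derive_eq.
      by apply: is_derive1_comp; exact: is_derive1_sqrt.
    rewrite /GRing.scale/= -/(half_circle t).
    by field; rewrite gt_eqF.
  have dp : is_derive t 1 (horner p) (p^`().[t]).
    by apply: DeriveDef; [exact: derivable_horner|rewrite -derive1E -derivE].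
  have -> : (fun t => half_circle t ^+ n.-1 * p.[t]) = (half_circle ^+ n.-1) * horner p.
    by apply/funext => x; rewrite !fctE.
  apply: is_derive_eq.
  rewrite /weighted powR_wexp//.
  have s2E : 1 - t ^+ 2 = half_circle t ^+ 2 by rewrite sqr_sqrtr// ltW.
  have -> : q.[t] = half_circle t ^+ 2 * p^`().[t] - n.-1%:R * (t * p.[t]).
    by rewrite -s2E /q !hornerE.
  rewrite exprfctE s2E /GRing.scale/=; case: n n2 {q qK} => // -[//|n] _ /=.
  rewrite exprS; field; exact: lt0r_neq0.
- by move=> x; exact: continuous_weighted.
Qed.

End GegenbauerWeight.

(** * Orthogonality of the Jacobi polynomials *)

Section MeanFunctional.
Variables (R : realType) (n : nat).
Hypothesis n2 : (2 <= n)%N.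
Implicit Types p q f : {poly R}.
Local Notation L := (@f0coef R n).

Lemma gam_gt0 : 0 < gam R n.
Proof.
rewrite invr_gt0; have -> : (fun=> 1) = horner (1 : {poly R}).
  by apply/funext => x; rewrite hornerE.
apply: wint_ge0_gt0 => //; first exact: oner_neq0.
by move=> x _; rewrite hornerE.
Qed.

Lemma f0coefD p q : L (p + q) = L p + L q.
Proof. by rewrite /f0coef -mulrDr -wintD. Qed.

Lemma f0coefZ c p : L (c *: p) = c * L p.
Proof. by rewrite /f0coef [LHS]/= wintZ// mulrCA. Qed.

Lemma f0coefN p : L (- p) = - L p.
Proof. by rewrite -scaleN1r f0coefZ mulN1r. Qed.

Lemma f0coefB p q : L (p - q) = L p - L q.
Proof. by rewrite f0coefD f0coefN. Qed.

Lemma f0coef0 : L 0 = 0.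
Proof. by rewrite -(scale0r 0) f0coefZ mul0r. Qed.

Lemma f0coef_sum (I : Type) (r : seq I) (P : pred I) (F : I -> {poly R}) :
  L (\sum_(i <- r | P i) F i) = \sum_(i <- r | P i) L (F i).
Proof. by apply: big_morph; [exact: f0coefD|exact: f0coef0]. Qed.

Lemma f0coef1 : L 1 = 1.
Proof.
rewrite /f0coef; have -> : horner (1 : {poly R}) = fun=> 1.
  by apply/funext => x; rewrite hornerE.
by apply: mulVf; have := gam_gt0; rewrite /gam invr_gt0 => /gt_eqF ->.
Qed.

Lemma f0coef_gt0 p : p != 0 -> (forall x, -1 < x < 1 -> 0 <= p.[x]) -> 0 < L p.
Proof. by move=> p0 pp; rewrite mulr_gt0 ?gam_gt0// wint_ge0_gt0. Qed.

Lemma f0coef_ibp p : L ((1 - 'X^2) * p^`() - n.-1%:R *: ('X * p)) = 0.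
Proof. by rewrite /f0coef wint_ibp// mulr0. Qed.

(* ((1-x)^A (1+x)^B f)' = (1-x)^(A-1) (1+x)^(B-1) jac_diff A B f *)
Let jac_diff (A B : R) f : {poly R} :=
  (1 - 'X^2) * f^`() + (B *: (1 - 'X) - A *: (1 + 'X)) * f.

Let wt (a b : nat) : {poly R} := (1 - 'X) ^+ a * (1 + 'X) ^+ b.

(** The extra factor x absorbs the truncated predecessor, so derivatives of powers need no separate
    case for exponent 0. *)
Lemma mul_exp_pred (T : comNzRingType) (x : T) (m : nat) : x * (x ^+ m.-1 *+ m) = x ^+ m *+ m.
Proof. by case: m => [|m]; rewrite ?mulr0// mulrnAr -exprS. Qed.

(** Integration by parts for [wt a b * f]. With w = (n-3)/2, the coefficient n - 1 = 2(w + 1) gives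
    w + 1 to each of the exponents of 1 - X and 1 + X. *)
Lemma f0coef_jac_diff (a b : nat) f :
  L (wt a b * jac_diff (a.+1%:R + wexp R n) (b.+1%:R + wexp R n) f) = 0.
Proof.
rewrite -[RHS](f0coef_ibp (wt a b * f)); congr L.
have d1 : (1 - 'X) * ((1 - 'X) ^+ a)^`() = - (1 - 'X : {poly R}) ^+ a *+ a.
  by rewrite deriv_exp derivB derivC derivX sub0r mulN1r mulNrn mulrN mul_exp_pred mulNrn.
have d2 : (1 + 'X) * ((1 + 'X) ^+ b)^`() = (1 + 'X : {poly R}) ^+ b *+ b.
  by rewrite deriv_exp derivD derivC derivX add0r mul1r mul_exp_pred.
have wn : n.-1%:R = 2 * wexp R n + 2.
  by rewrite /wexp; case: n n2 => // m _; rewrite -natr1 /=; field.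
rewrite /wt !derivM.
have -> : 1 - 'X^2 = (1 - 'X) * (1 + 'X) :> {poly R} by ring.
set u := (1 - 'X) ^+ a in d1 *; set v := (1 + 'X) ^+ b in d2 *.
transitivity ((1 - 'X) * (1 + 'X) * u * v * f^`() + ((1 + 'X) * v * f) * ((1 - 'X) * u^`())
   + ((1 - 'X) * u * f) * ((1 + 'X) * v^`()) - n.-1%:R *: ('X * (u * v * f))); last first.
  ring.
rewrite d1 d2 wn /jac_diff -[a.+1%:R]natr1 -[b.+1%:R]natr1 -[- u *+ a]mulr_natr -[v *+ b]mulr_natr.
by move: (wexp R n) => w; rewrite -!mul_polyC !polyCD polyCM !polyC_natr polyC1; ring.
Qed.

(** The falling factorial, which is the numerator of [gbinom]. *)
Let ff (x : R) (m : nat) : R := \prod_(i < m) (x - i%:R).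
Let U : {poly R} := 2^-1 *: ('X - 1).
Let V : {poly R} := 2^-1 *: ('X + 1).

(* Up to a constant factor, (1-x)^(m-A) (1+x)^(m-B) times the m-th derivative of
   (1-x)^A (1+x)^B. *)
Let rod (A B : R) (m : nat) : {poly R} :=
  \sum_(l < m.+1) ('C(m, l)%:R * ff A (m - l) * ff B l) *: (U ^+ l * V ^+ (m - l)).

(** One more differentiation in the Rodrigues formula, with [rod A B m] carrying the factor
    (1-x)^(A-m) (1+x)^(B-m). *)
Lemma rodS A B m : rod A B m.+1 = (- 2^-1) *: jac_diff (A - m%:R) (B - m%:R) (rod A B m).
Proof.
pose t (l : nat) : {poly R} := (ff A (m.+1 - l) * ff B l) *: (U ^+ l * V ^+ (m.+1 - l)).
(* Pascal's rule splits the sum so that the index l contributes the terms [t l] and [t l.+1];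
   together these are the image of the l-th summand of [rod A B m]. *)
have rodE : rod A B m.+1 = \sum_(l < m.+1) 'C(m, l)%:R *: t l +
    \sum_(l < m.+1) 'C(m, l)%:R *: t l.+1.
  have -> : \sum_(l < m.+1) 'C(m, l)%:R *: t l = \sum_(l < m.+2) 'C(m, l)%:R *: t l.
    by rewrite [RHS]big_ord_recr/= bin_small// scale0r addr0.
  rewrite big_ord_recl/= -addrA -big_split/= /rod big_ord_recl/=.
  congr (_ + _); first by rewrite !bin0 /t !scale1r mul1r.
  apply: eq_bigr => l _; rewrite /bump /= add1n binS natrD -scalerDl.
  by rewrite /t /= scalerA mulrA.
rewrite rodE /rod -big_split/=.
have jd_sum (F : 'I_m.+1 -> {poly R}) A' B' :
    jac_diff A' B' (\sum_(l < m.+1) F l) = \sum_(l < m.+1) jac_diff A' B' (F l).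
  by rewrite /jac_diff raddf_sum !mulr_sumr -big_split.
rewrite jd_sum scaler_sumr; apply: eq_bigr => l _.
have lm : (l <= m)%N by rewrite -ltnS.
have ffS x i : ff x i.+1 = ff x i * (x - i%:R) by rewrite /ff big_ord_recr.
have h2 : (2^-1)%:P * 2 = 1 :> {poly R} by rewrite -(polyC_natr R 2) -polyCM mulVf.
have dU : 2 * (U * (U ^+ l)^`()) = l%:R *: U ^+ l.
  rewrite deriv_exp /U derivZ derivB derivX derivC subr0 -/U alg_polyC.
  by rewrite -mulrnAr [U * (_ * _)]mulrCA mul_exp_pred mulrA [2 * _]mulrC h2 mul1r scaler_nat.
have dV : 2 * (V * (V ^+ (m - l))^`()) = (m - l)%:R *: V ^+ (m - l).
  rewrite deriv_exp /V derivZ derivD derivX derivC addr0 -/V alg_polyC.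
  by rewrite -mulrnAr [V * (_ * _)]mulrCA mul_exp_pred mulrA [2 * _]mulrC h2 mul1r scaler_nat.
rewrite /t subSn// !subSS !exprS !ffS {rodE jd_sum t}.
have XU : 'X = 2 *: U + 1 by rewrite /U scalerA divff ?scale1r ?subrK ?pnatr_eq0.
have VU : V = U + 1 by rewrite /V /U -!mul_polyC -[X in _ = _ + X]h2; ring.
have X2 : 1 - 'X^2 = - 4 *: (U * V) by rewrite VU XU -!mul_polyC; ring.
rewrite /jac_diff derivZ derivM.
set u := U ^+ l in dU *; set v := V ^+ (m - l) in dV *.
set c := 'C(m, l)%:R; set fa := ff A _; set fb := ff B _.
have -> : (1 - 'X^2) * ((c * fa * fb) *: (u^`() * v + u * v^`())) =
   - 2 *: ((c * fa * fb) *: ((2 * (U * u^`())) * (V * v) + (U * u) * (2 * (V * v^`())))).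
  by rewrite X2 -!mul_polyC !(polyCN, polyC_natr); ring.
rewrite dU dV.
have mlE : (m%:R : R) = (m - l)%:R + l%:R by rewrite -natrD subnK.
rewrite mlE XU VU -!mul_polyC; move: (m - l)%:R l%:R => x z.
(* [ring] treats the constant 2^-1 as an atom, so a factor 1 is first written as its product with
   2. *)
rewrite -[LHS]mul1r -h2 !(polyCM, polyCD, polyCN, polyC_natr); ring.
Qed.

(** One derivative is moved from [rod] to q: the total derivative has mean 0, and what remains pairs
    q' with the m-th [rod] for the parameters a+1 and b+1. The arguments A and B do not change, as
    (m+1) + a = m + (a+1). *)
Lemma rod_orth m : forall (a b : nat) q, (size q <= m)%N ->
  L (wt a b * (q * rod (m%:R + (a%:R + wexp R n)) (m%:R + (b%:R + wexp R n)) m)) = 0.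
Proof.
elim: m => [|m IH] a b q sq.
  by move: sq; rewrite leqn0 size_poly_eq0 => /eqP ->; rewrite mul0r mulr0 f0coef0.
set w := wexp R n; set A := _ + (a%:R + w); set B := _ + (b%:R + w).
rewrite rodS.
have -> : A - m%:R = a.+1%:R + w by rewrite /A -[m.+1%:R]natr1 -[a.+1%:R]natr1; ring.
have -> : B - m%:R = b.+1%:R + w by rewrite /B -[m.+1%:R]natr1 -[b.+1%:R]natr1; ring.
set G := rod A B m.
have -> : wt a b * (q * (- 2^-1 *: jac_diff (a.+1%:R + w) (b.+1%:R + w) G)) =
   (- 2^-1) *: (wt a b * jac_diff (a.+1%:R + w) (b.+1%:R + w) (q * G)) +
   2^-1 *: (wt a.+1 b.+1 * (q^`() * G)).
  rewrite /jac_diff /wt derivM !exprS -!mul_polyC polyCN.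
  ring.
rewrite f0coefD !f0coefZ f0coef_jac_diff.
have -> : G = rod (m%:R + (a.+1%:R + w)) (m%:R + (b.+1%:R + w)) m.
  by rewrite /G; congr (rod _ _ m); rewrite /A /B -[m.+1%:R]natr1 -?[a.+1%:R]natr1 -?[b.+1%:R]natr1; ring.
rewrite IH ?mulr0 ?addr0//.
have [->|q0] := eqVneq q 0; first by rewrite deriv0 size_poly0.
by rewrite -ltnS (leq_trans _ sq)// lt_size_deriv.
Qed.

Lemma jacobi_orth (k a b : nat) q : (size q <= k)%N ->
  L ((1 - 'X) ^+ a * (1 + 'X) ^+ b * (q * jacobi n k a b)) = 0.
Proof.
move=> sq; have := rod_orth a b sq.
have -> : rod (k%:R + (a%:R + wexp R n)) (k%:R + (b%:R + wexp R n)) k =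
  k`!%:R *: jacobi_std R k (a%:R + wexp R n) (b%:R + wexp R n).
  rewrite /rod /jacobi_std scaler_sumr; apply: eq_bigr => l _.
  rewrite scalerA; congr (_ *: _); rewrite /gbinom -/(ff _ _) -/(ff _ _).
  have lk : (l <= k)%N by rewrite -ltnS.
  rewrite -(bin_fact lk) !natrM; field.
  by rewrite !pnatr_eq0 -!lt0n !fact_gt0.
have scale_out c (r J : {poly R}) : r * (q * (c *: J)) = c *: (r * (q * J)).
  by rewrite -!mul_polyC; ring.
rewrite /jacobi !scale_out !f0coefZ => /eqP.
by rewrite mulf_eq0 pnatr_eq0 eqn0Ngt fact_gt0/= => /eqP ->; rewrite mulr0.
Qed.

End MeanFunctional.

(** * Quadrature *)

Section Quadrature.
Variables (R : realType) (n : nat).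
Hypothesis n2 : (2 <= n)%N.
Implicit Types (p q f : {poly R}) (D : seq R) (b : bool).
Local Notation L := (@f0coef R n).

Definition nodal D : {poly R} := \prod_(x <- D) ('X - x%:P).

Lemma size_nodal D : size (nodal D) = (size D).+1.
Proof. by rewrite /nodal size_prod_XsubC. Qed.

Lemma nodal_monic D : nodal D \is monic.
Proof. by rewrite /nodal monic_prod_XsubC. Qed.

Lemma root_nodal D x : root (nodal D) x = (x \in D).
Proof. by rewrite /nodal root_prod_XsubC. Qed.

Lemma nodal_rem D x : x \in D -> nodal D = ('X - x%:P) * nodal (rem x D).
Proof. by move=> xD; rewrite /nodal (big_rem x). Qed.

Lemma nodal_dvd D p : uniq D -> (forall x, x \in D -> root p x) ->
  exists q, p = q * nodal D.
Proof.
move=> uD Dp; apply/dvdpP; rewrite /nodal uniq_roots_dvdp ?uniq_rootsE//.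
exact/allP.
Qed.

Lemma size_jacobi_le k a b : (size (jacobi n k a b : {poly R}) <= k.+1)%N.
Proof.
rewrite /jacobi (leq_trans (size_scale_leq _ _))// /jacobi_std.
apply: (leq_trans (size_sum _ _ _)); apply/bigmax_leqP => l _.
rewrite (leq_trans (size_scale_leq _ _))//.
have sU (c : R) j : (size ((2^-1 *: ('X + c%:P)) ^+ j) <= j.+1)%N.
  rewrite (leq_trans (size_poly_exp_leq _ _))// ltnS -[X in (_ <= X)%N]mul1n leq_mul2r.
  by rewrite -subn1 leq_subLR (leq_trans (size_scale_leq _ _)) ?orbT// size_XaddC.
rewrite (leq_trans (size_polyMleq _ _))//.
have lk : (l <= k)%N by rewrite -ltnS.
apply: (@leq_trans (l.+1 + (k - l).+1).-1); last by lia.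
rewrite -!subn1 leq_sub2r// leq_add//; last exact: (sU 1).
by have := sU (-1) l; rewrite polyCN.
Qed.

(** The degree is at most [size D], and there are [size D] distinct roots. The polynomial is
    nonzero, for otherwise D would contain the [(size D).+1] numbers 0, 1, 2, and so on. *)
Lemma jacobi_nodal D a b : uniq D ->
  (forall t, root (jacobi n (size D) a b) t <-> t \in D) ->
  exists2 c, c != 0 & (jacobi n (size D) a b : {poly R}) = c *: nodal D.
Proof.
move=> uD rD; set J := jacobi _ _ _ _ in rD *.
have J0 : J != 0.
  apply/eqP => J0; have : (size [seq (i%:R : R) | i <- iota 0 (size D).+1] <= size D)%N.
    apply: uniq_leq_size; first by rewrite map_inj_uniq ?iota_uniq//; exact: mulrIn (oner_neq0 _).
    by move=> x _; apply/rD; rewrite J0 root0.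
  by rewrite size_map size_iota ltnn.
have allD : all (root J) D by apply/allP => x /rD.
exists (lead_coef J); first by rewrite lead_coef_eq0.
apply: all_roots_prod_XsubC => //; last by rewrite uniq_rootsE.
apply/eqP; rewrite eqn_leq size_jacobi_le/=.
exact: max_poly_roots.
Qed.

Section Nodes.
Variables (D : seq R) (b : bool).
Hypothesis uD : uniq D.
Hypothesis rD : forall t, root (jacobi n (size D) 1 b) t <-> t \in D.

Lemma nodal_orth q : (size q <= size D)%N ->
  L ((1 - 'X) * (1 + 'X) ^+ b * (q * nodal D)) = 0.
Proof.
move=> sq; have [c c0 JE] := jacobi_nodal uD rD.
have := jacobi_orth n2 1 b sq; rewrite JE expr1.
have -> : (1 - 'X) * (1 + 'X) ^+ b * (q * (c *: nodal D)) =
    c *: ((1 - 'X) * (1 + 'X) ^+ b * (q * nodal D)).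
  by rewrite -!mul_polyC; ring.
by rewrite f0coefZ// => /eqP; rewrite mulf_eq0 (negPf c0) => /eqP.
Qed.

Lemma edge_factor_ge0 (x : R) : -1 <= x <= 1 -> 0 <= ((1 - 'X) * (1 + 'X) ^+ b).[x].
Proof. by move=> xI; rewrite !hornerE mulr_ge0 ?exprn_ge0//; lra. Qed.

Lemma edge_factor_neq0 : (1 - 'X) * (1 + 'X) ^+ b != 0 :> {poly R}.
Proof.
apply/eqP => e0; have : ((1 - 'X) * (1 + 'X) ^+ b : {poly R}).[0] = 1.
  by rewrite !hornerE ?(subr0, addr0, expr1n, mulr1).
by rewrite e0 horner0 => /eqP; rewrite eq_sym oner_eq0.
Qed.

(* Were x outside, orthogonality to nodal D / (X - x) would contradict positivity. *)
Lemma nodal_interior x : x \in D -> -1 < x < 1.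
Proof.
move=> xD; set w := nodal (rem x D).
have srem : (size (nodal (rem x D)) <= size D)%N.
  by rewrite size_nodal size_rem// prednK//; case: (D) xD.
have := nodal_orth srem; rewrite (nodal_rem xD) -/w.
set e := (1 - 'X) * _; have -> : e * (w * (('X - x%:P) * w)) = e * ('X - x%:P) * w ^+ 2 by ring.
have p0 : e * ('X - x%:P) * w ^+ 2 != 0.
  apply: mulf_neq0; last exact/expf_neq0/monic_neq0/nodal_monic.
  apply: mulf_neq0; [exact: edge_factor_neq0|exact/monic_neq0/monicXsubC].
have ev (y : R) : (e * ('X - x%:P) * w ^+ 2).[y] = e.[y] * w.[y] ^+ 2 * (y - x).
  by rewrite !hornerM hornerXsubC horner_exp; ring.
have e0 (y : R) : -1 < y < 1 -> 0 <= e.[y] * w.[y] ^+ 2.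
  by move=> yI; rewrite mulr_ge0 ?sqr_ge0//; apply: edge_factor_ge0; lra.
have [x1|x1] := leP x (-1) => [L0|].
  have /(f0coef_gt0 n2 p0) : forall y : R, -1 < y < 1 -> 0 <= (e * ('X - x%:P) * w ^+ 2).[y].
    by move=> y yI; rewrite ev mulr_ge0 ?e0//; lra.
  by rewrite L0 ltxx.
have [x2|x2 _] := leP 1 x; last by [].
move=> L0.
have p0' : - (e * ('X - x%:P) * w ^+ 2) != 0 by rewrite oppr_eq0.
have /(f0coef_gt0 n2 p0') : forall y : R, -1 < y < 1 -> 0 <= (- (e * ('X - x%:P) * w ^+ 2)).[y].
  by move=> y yI; rewrite hornerN ev -mulrN mulr_ge0 ?e0//; lra.
by rewrite f0coefN// L0 oppr0 ltxx.
Qed.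

(** Here [b] is also the exponent of 1 + X in the weight; it becomes [~~ eps] in the end, since -1
    is a node only for even tau + 1. *)
Definition edges : seq R := 1 :: nseq b (-1).

Lemma uniq_nodes : uniq (edges ++ D).
Proof.
have h : forall x, x \in D -> (x != 1) && (x != -1).
  by move=> x /nodal_interior xI; apply/andP; split; apply/eqP => xE; move: xI; rewrite xE; lra.
have D1 : 1 \notin D by apply/negP => /h; rewrite eqxx.
have D2 : -1 \notin D by apply/negP => /h; rewrite eqxx andbF.
rewrite /edges; case: b => /=; rewrite ?inE ?negb_or D1 ?D2 uD ?andbT//.
by apply/eqP; lra.
Qed.

Lemma nodal_edges : nodal (edges ++ D) = - ((1 - 'X) * (1 + 'X) ^+ b * nodal D).
Proof.
rewrite /nodal big_cat/= /edges big_cons -mulNr; congr (_ * _).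
by case: b; rewrite /= ?big_cons ?big_nil ?expr1 ?expr0 ?polyCN; ring.
Qed.

Variables (al : nat -> R) (I : seq nat).
Hypothesis alI : perm_eq [seq al i | i <- I] (edges ++ D).

Lemma uniq_al : uniq [seq al i | i <- I].
Proof. by rewrite (perm_uniq alI) uniq_nodes. Qed.

Lemma al_inj i j : i \in I -> j \in I -> al i = al j -> i = j.
Proof.
move=> iI jI e; have /(uniqP 0) u := uniq_al.
rewrite -(nth_index 0%N iI) -(nth_index 0%N jI); congr nth; apply: u.
- by rewrite inE size_map index_mem.
- by rewrite inE size_map index_mem.
by rewrite !(nth_map 0%N) ?index_mem// !nth_index.
Qed.

Lemma uniq_I : uniq I.
Proof. exact: map_uniq uniq_al. Qed.

Lemma lagrE i j : i \in I -> j \in I -> (lagr al I i).[al j] = (i == j)%:R.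
Proof.
move=> iI jI; rewrite /lagr horner_prod; have [->|ij] := eqVneq i j.
  rewrite big_seq_cond big1// => l /andP[lI lj]; rewrite hornerZ hornerXsubC mulVf//.
  by rewrite subr_eq0; apply: contraNneq lj => /al_inj ->.
apply/eqP; rewrite prodf_seq_eq0; apply/hasP; exists j => //.
by rewrite eq_sym ij hornerZ hornerXsubC subrr mulr0 eqxx.
Qed.

Lemma size_lagr i : i \in I -> (size (lagr al I i) <= size I)%N.
Proof.
move=> iI; rewrite /lagr scaler_prod (leq_trans (size_scale_leq _ _))//.
rewrite -big_filter size_prod_XsubC -(rem_filter _ uniq_I) size_rem//.
by rewrite prednK//; case: (I) iI.
Qed.

(** The difference of f and its Lagrange interpolant [F] is q times the nodal polynomial of all
    nodes. Counting degrees gives [size q <= size D], so [nodal_orth] makes its mean 0. *)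
Lemma quadrature f : (size f <= 2 * size D + 1 + b)%N ->
  L f = \sum_(i <- I) L (lagr al I i) * f.[al i].
Proof.
move=> sf; pose F : {poly R} := \sum_(i <- I) f.[al i] *: lagr al I i.
have sI : size I = (size D + 1 + b)%N.
  by rewrite -(size_map al) (perm_size alI) size_cat/= size_nseq; lia.
have -> : \sum_(i <- I) L (lagr al I i) * f.[al i] = L F.
  by rewrite f0coef_sum//; apply: eq_bigr => i _; rewrite f0coefZ// mulrC.
have [x xD|q rE] := @nodal_dvd (edges ++ D) (f - F) uniq_nodes.
  rewrite -(perm_mem alI) in xD; have /mapP[j jI ->] := xD.
  rewrite /root hornerD hornerN horner_sum (big_rem j)//= hornerZ lagrE// eqxx mulr1.
  rewrite big_seq big1 ?addr0 ?subrr// => i.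
  rewrite (mem_rem_uniq _ uniq_I) => /andP[/= ij iI].
  by rewrite hornerZ lagrE// (negPf ij) mulr0.
have [q0|q0] := eqVneq q 0.
  by move: rE; rewrite q0 mul0r => /eqP; rewrite subr_eq0 => /eqP ->.
have sF : (size F <= 2 * size D + 1 + b)%N.
  rewrite /F big_seq; apply: (leq_trans (size_sum _ _ _)); apply/bigmax_leqP_seq => i iI _.
  rewrite (leq_trans (size_scale_leq _ _))// (leq_trans (size_lagr iI))// sI; lia.
have sq : (size q <= size D)%N.
  have : (size (f - F)%R <= 2 * size D + 1 + b)%N.
    by rewrite (leq_trans (size_polyD _ _))// geq_max sf size_polyN.
  rewrite rE size_Mmonic ?nodal_monic// size_nodal size_cat/= size_nseq; lia.
apply/eqP; rewrite -subr_eq0 -f0coefB// rE nodal_edges.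
have -> : q * - ((1 - 'X) * (1 + 'X) ^+ b * nodal D) = - ((1 - 'X) * (1 + 'X) ^+ b * (q * nodal D)) by ring.
by rewrite f0coefN// nodal_orth// oppr0.
Qed.

(** Quadrature for g has a single nonzero term, the one at node i, while the mean of g is
    positive. *)
Lemma quadrature_weight_witness i (g : {poly R}) : i \in I -> (size g <= 2 * size D + 1 + b)%N ->
  (forall x : R, -1 < x < 1 -> 0 <= g.[x]) -> 0 < g.[al i] ->
  (forall x, x \in rem (al i) (edges ++ D) -> g.[x] = 0) ->
  0 < L (lagr al I i).
Proof.
move=> iI sg g0 gi gx; have g_neq0 : g != 0.
  by apply: contraTneq gi => ->; rewrite horner0 ltxx.
have := f0coef_gt0 n2 g_neq0 g0; rewrite quadrature// (big_rem i)//= big_seq big1.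
  by rewrite addr0 pmulr_lgt0.
move=> j; rewrite (mem_rem_uniq _ uniq_I) => /andP[/= ji jI].
rewrite gx ?mulr0// (mem_rem_uniq _ uniq_nodes) inE -(perm_mem alI) map_f// andbT.
by apply: contraNneq ji => /al_inj ->.
Qed.

Lemma size_nodal_sqr E : size (nodal E ^+ 2) = (2 * size E).+1.
Proof. rewrite expr2 size_Mmonic ?monic_neq0 ?nodal_monic// size_nodal; lia. Qed.

Lemma size_pow_edge : (size ((1 + 'X : {poly R}) ^+ b) <= b.+1)%N.
Proof.
rewrite (leq_trans (size_poly_exp_leq _ _))//.
by rewrite addrC -polyC1 size_XaddC mul1n.
Qed.

Lemma size_one_minus_X : size (1 - 'X : {poly R}) = 2%N.
Proof. by rewrite -size_polyN opprB -polyC1 size_XsubC. Qed.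

Lemma size_edge_factor : (size ((1 - 'X : {poly R}) * (1 + 'X) ^+ b)%R <= b.+2)%N.
Proof.
rewrite (leq_trans (size_polyMleq _ _))// size_one_minus_X.
by have := size_pow_edge; move: (size _) => m; lia.
Qed.

Lemma nodal_eq0 E (x : R) : x \in E -> (nodal E).[x] = 0.
Proof. by move=> xE; apply/rootP; rewrite root_nodal. Qed.

Lemma nodal_sqr_gt0 E (x : R) : x \notin E -> 0 < (nodal E).[x] ^+ 2.
Proof. by move=> xE; rewrite exprn_even_gt0//= -rootE root_nodal. Qed.

Lemma horner_1pX (x : R) : (1 + 'X).[x] = 1 + x.
Proof. by rewrite !hornerE. Qed.

Lemma horner_1mX (x : R) : (1 - 'X).[x] = 1 - x.
Proof. by rewrite !hornerE. Qed.

(** The witness is the squared nodal polynomial of the other interior nodes, times the linear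
    factors, nonnegative on [-1,1], that vanish at the other end nodes. *)
Lemma quadrature_weight_gt0 i : i \in I -> 0 < L (lagr al I i).
Proof.
move=> iI; have : al i \in edges ++ D by rewrite -(perm_mem alI) map_f.
have Dx x : (x == 1) || (x == -1) -> x \notin D.
  by move=> /orP[] /eqP ->; apply/negP => /nodal_interior; lra.
have remE y : y \in rem (al i) (edges ++ D) -> (y != al i) && [|| y == 1, b && (y == -1) | y \in D].
  rewrite (mem_rem_uniq _ uniq_nodes) => h.
  have /andP[-> yE] : (y != al i) && (y \in edges ++ D) := h.
  by move: yE; rewrite mem_cat /edges inE mem_nseq lt0b -orbA.
rewrite mem_cat => /orP[|iD].
  rewrite /edges inE => /orP[/eqP i1|].
    apply: (@quadrature_weight_witness _ ((1 + 'X) ^+ b * nodal D ^+ 2)) => //.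
    - have := size_polyMleq ((1 + 'X) ^+ b) (nodal D ^+ 2).
      by have := size_pow_edge; rewrite size_nodal_sqr; lia.
    - move=> x xI; rewrite hornerM !horner_exp mulr_ge0 ?sqr_ge0// exprn_ge0// ?(horner_1pX, horner_1mX); lra.
    - rewrite i1 hornerM !horner_exp mulr_gt0 ?nodal_sqr_gt0 ?Dx ?eqxx// exprn_gt0// ?(horner_1pX, horner_1mX); lra.
    - move=> x /remE; rewrite i1 hornerM !horner_exp => /andP[/negPf -> /=] /orP[/andP[bT /eqP ->]|xD].
        by rewrite bT expr1 horner_1pX subrr mul0r.
      by rewrite nodal_eq0//; ring.
  rewrite mem_nseq => /andP[b0 /eqP i1].
  apply: (@quadrature_weight_witness _ ((1 - 'X) * nodal D ^+ 2)) => //.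
  - have := size_polyMleq (1 - 'X) (nodal D ^+ 2).
    case: (b) b0 => // _; rewrite size_one_minus_X size_nodal_sqr => /leq_trans; apply.
    by rewrite /=; lia.
  - move=> x xI; rewrite hornerM !horner_exp mulr_ge0 ?sqr_ge0// ?(horner_1pX, horner_1mX); lra.
  - rewrite i1 hornerM !horner_exp mulr_gt0 ?nodal_sqr_gt0 ?Dx ?eqxx ?orbT// ?(horner_1pX, horner_1mX); lra.
  - move=> x /remE; rewrite i1 hornerM !horner_exp => /andP[/negPf ->]; rewrite andbF /=.
    move=> /orP[/eqP ->|xD]; first by rewrite horner_1mX subrr !mul0r.
    by rewrite nodal_eq0//; ring.
have uD' : al i \notin rem (al i) D by rewrite mem_rem_uniqF.
have := nodal_interior iD => iI1.
apply: (@quadrature_weight_witness _ ((1 - 'X) * (1 + 'X) ^+ b * nodal (rem (al i) D) ^+ 2)) => //.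
- have d0 : (0 < size D)%N by case: (D) iD.
  apply: (leq_trans (size_polyMleq _ _)); rewrite size_nodal_sqr size_rem//.
  apply: (@leq_trans (b.+2 + (2 * (size D).-1).+1).-1); last by lia.
  by rewrite -!subn1 leq_sub2r// leq_add2r size_edge_factor.
- move=> x xI; rewrite hornerM horner_exp mulr_ge0 ?sqr_ge0//; apply: edge_factor_ge0; lra.
- rewrite hornerM horner_exp mulr_gt0 ?nodal_sqr_gt0// hornerM horner_exp mulr_gt0 ?exprn_gt0// ?(horner_1pX, horner_1mX); lra.
- move=> x /remE; rewrite !hornerM !horner_exp => /andP[xi] /or3P[/eqP ->|/andP[bT /eqP ->]|xD].
  + by rewrite horner_1mX subrr !mul0r.
  + by rewrite bT expr1 horner_1pX subrr !(mulr0, mul0r).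
  + by rewrite (@nodal_eq0 (rem _ _)) ?mem_rem_uniq// ?inE ?xi//; ring.
Qed.

Lemma quadrature_weight_sum : \sum_(i <- I) L (lagr al I i) = 1.
Proof.
rewrite -(f0coef1 R n2) quadrature ?size_poly1; last by lia.
by apply: eq_bigr => i _; rewrite hornerC mulr1.
Qed.

End Nodes.
End Quadrature.

(** * Hermite interpolation *)

Section RolleCounting.
Variable R : realType.

(** [psi] plays the derivative of [phi], and [A] marks the points where Rolle's theorem may be
    applied. The new zeros avoid the old ones, so that double nodes can be adjoined later without
    repetition, and lie strictly between two of them, so that they stay in the open interval. *)
Lemma rolle_sorted (A : R -> Prop) (phi psi : R -> R) :
  (forall x y, A x -> A y -> x < y -> phi x = 0 -> phi y = 0 ->
     exists2 c, x < c < y & psi c = 0) ->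
  forall (s : seq R) x, path <%R x s ->
  (forall z, z \in x :: s -> A z /\ phi z = 0) ->
  exists r : seq R, [/\ size r = size s, path <%R x r &
    forall z, z \in r -> [/\ psi z = 0, z \notin x :: s &
      exists a c, [/\ a \in x :: s, c \in x :: s & a < z < c]]].
Proof.
move=> rolle; elim=> [|y s IH] x /=; first by exists [::].
move=> /andP[xy ps] As.
have [z zs|r [sr pr rP]] := IH y ps; first by apply: As; rewrite inE zs orbT.
have [Ax px] := As x (mem_head _ _).
have [Ay py] : A y /\ phi y = 0 by apply: As; rewrite !inE eqxx orbT.
have [c /andP[xc cy] pc] := rolle x y Ax Ay xy px py.
have ltall (l : seq R) (u v : R) : path <%R u l -> v \in l -> u < v.
  by move=> /(order_path_min lt_trans)/allP h /h.
exists (c :: r); split => /=; first by rewrite sr.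
  by rewrite xc /=; case: r pr {sr rP} => //= a r /andP[ya ->]; rewrite (lt_trans cy ya).
move=> z; rewrite inE => /orP[/eqP ->|zr].
  split=> //; last by exists x, y; rewrite !inE !eqxx orbT xc cy.
  rewrite !inE !negb_or gt_eqF// lt_eqF//=.
  by apply/negP => /(ltall _ _ _ ps); rewrite ltNge (ltW cy).
have [pz znys [a [d [ays dys azd]]]] := rP z zr; split=> //.
  by rewrite inE negb_or znys andbT gt_eqF// (lt_trans xy)// (ltall _ _ _ pr).
by exists a, d; rewrite inE ays orbT inE dys orbT.
Qed.

Lemma rolle_uniq (A : R -> Prop) (phi psi : R -> R) :
  (forall x y, A x -> A y -> x < y -> phi x = 0 -> phi y = 0 ->
     exists2 c, x < c < y & psi c = 0) ->
  forall s : seq R, uniq s -> (forall z, z \in s -> A z /\ phi z = 0) ->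
  exists r : seq R, [/\ size r = (size s).-1, uniq r &
    forall z, z \in r -> [/\ psi z = 0, z \notin s &
      exists a c, [/\ a \in s, c \in s & a < z < c]]].
Proof.
move=> rolle s us As; have perm_s := perm_sort <=%R s.
have lts : sorted <%R (sort <=%R s) by rewrite sort_lt_sorted.
have memE z : (z \in sort <=%R s) = (z \in s) by rewrite mem_sort.
rewrite -(size_sort <=%R s).
case: (sort _ _) lts memE {perm_s} => [_ _|x l /= pl memE]; first by exists [::].
have [z|r [sr pr rP]] := rolle_sorted rolle pl; first by rewrite memE => /As.
exists r; split=> //.
  by apply: (sorted_uniq lt_trans lt_irreflexive); exact: path_sorted pr.
move=> z /rP[pz zn [a [c [ax cx azc]]]]; split=> //; first by rewrite -memE.
by exists a, c; rewrite -!memE.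
Qed.

(** Each differentiation costs one zero, so [d.+1] zeros leave one after d steps. *)
Lemma rolle_iter (m : nat) (phi : nat -> R -> R) :
  (forall j (x : R), (j < m)%N -> -1 < x < 1 -> is_derive x 1 (phi j) (phi j.+1 x)) ->
  forall (d j : nat) (s : seq R), uniq s -> size s = d.+1 -> (j + d <= m)%N ->
  (forall z, z \in s -> -1 < z < 1 /\ phi j z = 0) ->
  exists2 c, -1 < c < 1 & phi (j + d)%N c = 0.
Proof.
move=> dphi; elim=> [|d IH] j s us ss jd sP.
  case: s ss us sP => // z s _ _ /(_ z (mem_head _ _))[zI pz].
  by exists z => //; rewrite addn0.
have rolle (x y : R) : -1 < x < 1 -> -1 < y < 1 -> x < y -> phi j x = 0 -> phi j y = 0 ->
    exists2 c, x < c < y & phi j.+1 c = 0.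
  move=> xI yI xy px py.
  have dj z : z \in `[x, y] -> is_derive z 1 (phi j) (phi j.+1 z).
    by rewrite in_itv/= => zI; apply: dphi; [lia|lra].
  have [z zI|||c cI dc] := @Rolle R (phi j) x y xy.
  - by have /dj[] : z \in `[x, y] by apply: subset_itv_oo_cc zI.
  - by apply: derivable_within_continuous => z /dj[].
  - by rewrite px py.
  exists c; first by move: cI; rewrite in_itv.
  have [_ <-] : is_derive c 1 (phi j) (phi j.+1 c).
    by apply: dj; apply: subset_itv_oo_cc cI.
  by have [_ ->] := dc.
have [r [sr ur rP]] := rolle_uniq rolle us sP.
rewrite -addSnnS; apply: (IH j.+1 r) => //.
- by rewrite sr ss.
- by rewrite addSnnS.
move=> z /rP[pz _ [a [c [/sP[aI _] /sP[cI _] azc]]]]; split=> //; lra.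
Qed.

End RolleCounting.

Section Hermite.
Variable R : realType.
Implicit Types (S D X : seq R) (f p q : {poly R}).

(** Newton's form: a multiple of the nodal polynomial of the old nodes corrects the value at the new
    one. *)
Lemma lagrange_interpolation X (v : R -> R) : uniq X ->
  exists2 p : {poly R}, (size p <= size X)%N & forall x, x \in X -> p.[x] = v x.
Proof.
elim: X => [|x X IH] /=; first by exists 0; rewrite ?size_poly0.
move=> /andP[xX /IH[p sp pv]].
have w0 : (nodal X).[x] != 0 by rewrite -rootE root_nodal.
exists (p + ((v x - p.[x]) / (nodal X).[x]) *: nodal X).
  rewrite (leq_trans (size_polyD _ _))// geq_max (leq_trans sp)//=.
  by rewrite (leq_trans (size_scale_leq _ _))// size_nodal.
move=> y; rewrite inE hornerD hornerZ => /orP[/eqP ->|yX]; first by rewrite divfK//; ring.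
by rewrite [(nodal X).[y]]nodal_eq0// mulr0 addr0 pv.
Qed.

Lemma deriv_nodal_neq0 X x : uniq X -> x \in X -> ((nodal X)^`()).[x] != 0.
Proof.
move=> uX xX; rewrite (nodal_rem xX) derivM hornerD !hornerM hornerXsubC subrr mul0r addr0.
rewrite derivXsubC hornerC mul1r -rootE root_nodal.
by rewrite mem_rem_uniqF.
Qed.

(** Adding [nodal X * q] to a Lagrange interpolant keeps its values on X and changes the derivative
    at a node by (nodal X)' q, so that q solves a second Lagrange problem, on D. *)
Lemma hermite_interpolation S D (v v' : R -> R) : uniq (S ++ D) ->
  exists f : {poly R}, [/\ (size f <= size S + 2 * size D)%N,
    forall x, x \in S ++ D -> f.[x] = v x & forall x, x \in D -> f^`().[x] = v' x].
Proof.
move=> uX; set X := S ++ D in uX *.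
have [p sp pv] := lagrange_interpolation v uX.
have uD : uniq D by move: uX; rewrite cat_uniq => /and3P[].
have [q sq qv] := lagrange_interpolation (fun x => (v' x - p^`().[x]) / ((nodal X)^`()).[x]) uD.
exists (p + nodal X * q); split.
- rewrite (leq_trans (size_polyD _ _))// geq_max (leq_trans sp) ?size_cat ?leq_add2l ?mul2n -?addnn ?leq_addr//.
  apply: (leq_trans (size_polyMleq _ _)); rewrite size_nodal size_cat /= addnA leq_add2l//.
- by move=> x xX; rewrite hornerD hornerM [(nodal X).[x]]nodal_eq0// mul0r addr0 pv.
move=> x xD; have xX : x \in X by rewrite mem_cat xD orbT.
rewrite derivD derivM !hornerD !hornerM [(nodal X).[x]]nodal_eq0//.
rewrite mul0r addr0 qv// mulrC divfK ?deriv_nodal_neq0//; ring.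
Qed.

(** [Z] is the domain of the error formula: the open interval while h may still be infinite at the
    ends, and later all points of [-1,1] where h is finite. *)
Variables (g : R -> R) (m : nat) (Z : set R).
Hypothesis Zsub : forall x, Z x -> -1 <= x <= 1.
Hypothesis gcont : forall x y, Z x -> Z y -> x < y -> {within `[x, y], continuous g}.
Hypothesis gder : forall j t, (j < m)%N -> -1 < t < 1 -> derivable (derive1n j g) t 1.

Lemma is_derive_sub_poly p j (t : R) : (j < m)%N -> -1 < t < 1 ->
  is_derive t 1 (fun x => derive1n j g x - (p^`(j)).[x])
    (derive1n j.+1 g t - (p^`(j.+1)).[t]).
Proof.
move=> jm tI; have d1 : is_derive t 1 (derive1n j g) (derive1n j.+1 g t).
  by apply: DeriveDef; [exact: gder|rewrite derive1nS derive1E].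
have d2 : is_derive t 1 (horner p^`(j)) (p^`(j.+1)).[t].
  by apply: DeriveDef; [exact: derivable_horner|rewrite -derive1E -derivE derivnS].
exact: is_deriveB.
Qed.

(* Rolle counting on g - f - K W, where W is the monic polynomial vanishing at the nodes
   and K is chosen to produce the extra zero t. *)
Lemma hermite_error S D f : (0 < m)%N -> uniq (S ++ D) -> (size S + 2 * size D = m)%N ->
  (forall x, x \in S ++ D -> Z x) -> (forall x, x \in D -> -1 < x < 1) ->
  (size f <= m)%N ->
  (forall x, x \in S ++ D -> f.[x] = g x) -> (forall x, x \in D -> f^`().[x] = derive1 g x) ->
  forall t, Z t -> exists2 c, -1 < c < 1 &
    g t - f.[t] = derive1n m g c / m`!%:R * ((nodal S).[t] * (nodal D).[t] ^+ 2).
Proof.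
move=> m0 uX szm XZ DI sf fX f'D t Zt.
have [tX|tX] := boolP (t \in S ++ D).
  (* Both sides vanish at a node, so any c in the open interval will do. *)
  exists 0; first by lra.
  rewrite fX// subrr; suff -> : (nodal S).[t] * (nodal D).[t] ^+ 2 = 0 by rewrite mulr0.
  move: tX; rewrite mem_cat => /orP[tS|tD].
    by rewrite [(nodal S).[t]]nodal_eq0// mul0r.
  by rewrite [(nodal D).[t]]nodal_eq0// expr0n mulr0.
pose W := nodal S * nodal D ^+ 2.
have Wm : W \is monic by rewrite monicMr ?monic_exp ?nodal_monic.
have sW : size W = m.+1.
  by rewrite /W size_Mmonic ?monic_exp ?monic_neq0 ?nodal_monic// expr2 size_Mmonic ?monic_neq0 ?nodal_monic// !size_nodal; lia.
have Wt : W.[t] != 0.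
  move: tX; rewrite mem_cat negb_or => /andP[tS tD].
  by rewrite /W hornerM horner_exp mulf_neq0 ?expf_neq0// -rootE root_nodal.
pose K := (g t - f.[t]) / W.[t]; pose p := f + K *: W.
pose phi j x := derive1n j g x - (p^`(j)).[x].
have dphi j (x : R) : (j < m)%N -> -1 < x < 1 -> is_derive x 1 (phi j) (phi j.+1 x).
  exact: is_derive_sub_poly.
have WX x : x \in S ++ D -> W.[x] = 0.
  move=> xX; rewrite /W hornerM horner_exp; move: xX; rewrite mem_cat => /orP[xS|xD].
    by rewrite [(nodal S).[x]]nodal_eq0// mul0r.
  by rewrite [(nodal D).[x]]nodal_eq0// expr0n mulr0.
have phi0 x : x \in t :: S ++ D -> Z x /\ phi 0%N x = 0.
  rewrite inE => /orP[/eqP ->|xX].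
    by split=> //; rewrite /phi derivn0 /p hornerD hornerZ /K divfK//=; ring.
  by split; [exact: XZ|rewrite /phi derivn0 /p hornerD hornerZ WX//= fX//; ring].
have rolle x y : Z x -> Z y -> x < y -> phi 0%N x = 0 -> phi 0%N y = 0 ->
    exists2 c, x < c < y & phi 1%N c = 0.
  move=> Zx Zy xy px py; have := Zsub Zx; have := Zsub Zy => yI xI.
  have inI z : z \in `]x, y[ -> -1 < z < 1 by rewrite in_itv/=; lra.
  have [z /inI zI|||c cI dc] := @Rolle R (phi 0%N) x y xy.
  - by have [] := dphi 0%N z m0 zI.
  - have -> : phi 0%N = (g - horner p) by apply/funext => z; rewrite /phi derivn0.
    move=> z; apply: cvgB; first exact: (gcont Zx Zy xy).
    by apply: continuous_subspaceT; exact: continuous_horner.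
  - by rewrite px py.
  exists c; first by move: cI; rewrite in_itv.
  have [_ <-] := dphi 0%N c m0 (inI _ cI).
  by have [_ ->] := dc.
(* The zeros t, S and D of [phi 0] give [size S + size D] zeros of [phi 1], none of them in D. The
   points of D are further zeros of [phi 1], which makes m in all. *)
have [|r [sr ur rP]] := rolle_uniq rolle _ phi0; first by rewrite /= tX uX.
have uD : uniq D by move: uX; rewrite cat_uniq => /and3P[].
have ZI z : z \in t :: S ++ D -> -1 <= z <= 1 by move=> /phi0[/Zsub].
have phi1 z : z \in r ++ D -> -1 < z < 1 /\ phi 1%N z = 0.
  rewrite mem_cat => /orP[/rP[pz _ [a [d [/ZI aI /ZI dI azd]]]]|zD].
    by split=> //; lra.
  have zX : z \in S ++ D by rewrite mem_cat zD orbT.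
  split; first exact: DI.
  rewrite /phi derivn1 /p derivD derivZ hornerD hornerZ f'D//.
  have -> : (W^`()).[z] = 0.
    rewrite /W derivM deriv_exp !(hornerD, hornerM, hornerMn, horner_exp).
    by rewrite [(nodal D).[z]]nodal_eq0// expr0n !(mulr0, mul0r, mul0rn, addr0).
  by rewrite derive1n1; ring.
have urD : uniq (r ++ D).
  rewrite cat_uniq ur uD andbT; apply/hasPn => z zD; apply/negP => /rP[_ + _].
  by rewrite inE mem_cat zD !orbT.
have srD : size (r ++ D) = m.-1.+1.
  by rewrite prednK// size_cat sr /= size_cat -szm; lia.
have le1m : (1 + m.-1 <= m)%N by rewrite add1n prednK.
have [c cI] := rolle_iter dphi urD srD le1m phi1.
rewrite add1n prednK// => phic; exists c => //.
(* W is monic of degree m and f has smaller degree, so only K W contributes. *)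
have pm : (p^`(m)).[c] = K * m`!%:R.
  have pc : p`_m = K.
    rewrite coefD coefZ (nth_default 0 sf) add0r.
    by move/monicP : Wm; rewrite lead_coefE sW /= => ->; rewrite mulr1.
  have sp : (size p <= m.+1)%N.
    rewrite (leq_trans (size_polyD _ _))// geq_max (leq_trans sf)//=.
    by rewrite (leq_trans (size_scale_leq _ _))// sW.
  have -> : p^`(m) = (K *+ m`!)%:P.
    apply/polyP => i; rewrite coef_derivn coefC; case: i => [|i] /=.
      by rewrite addn0 pc ffactnn.
    by rewrite nth_default ?mul0rn// (leq_trans sp)// addnS ltnS leq_addr.
  by rewrite hornerC mulr_natr.
move: phic; rewrite /phi pm => /eqP; rewrite subr_eq0 => /eqP ->.
rewrite mulfK ?pnatr_eq0 -?lt0n ?fact_gt0//.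
rewrite /K; have -> : (nodal S).[t] * (nodal D).[t] ^+ 2 = W.[t] by rewrite /W hornerM horner_exp.
by rewrite divfK.
Qed.

End Hermite.

(** * The lower interpolant of the potential *)

Section Potential.
Variables (R : realType) (tau : nat) (h : R -> \bar R).
Hypothesis hok : potential_ok tau h.
Let g := fine \o h.

(** Finiteness has to be assumed only at x and y, as every point strictly between them lies in ]-1,
    1[. *)
Lemma potential_fin_continuous x y : -1 <= x -> y <= 1 ->
  h x \is a fin_num -> h y \is a fin_num -> {within `[x, y], continuous g}.
Proof.
move=> x1 y1 hx hy; have [_ hfin hcont _ _] := hok.
apply/subspace_continuousP => z; rewrite /= in_itv/= => /andP[xz zy].
have hz : h z \is a fin_num.
  have [->//|nzx] := eqVneq z x; have [->//|nzy] := eqVneq z y.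
  have xz' : x < z by rewrite lt_neqAle eq_sym nzx.
  have zy' : z < y by rewrite lt_neqAle nzy.
  by apply: hfin; lra.
have /subspace_continuousP/(_ z) hz1 := hcont.
have zI : `[(-1)%R, 1%R]%classic z by rewrite /= in_itv/=; lra.
apply: fine_cvg; rewrite fineK//.
apply: cvg_trans (hz1 zI); apply: cvg_app.
move=> P zP; have {}zP : \forall u \near z, `[(-1)%R, 1%R]%classic u -> P u := zP.
suff : \forall u \near z, `[x, y]%classic u -> P u by [].
apply: filterS zP => u uP uI; apply: uP; move: uI; rewrite /= !in_itv/=; lra.
Qed.

(** As a is 1 or -1, each factor t + a/(i+2) equals a (a t + 1/(i+2)), and the m signs multiply to
    1. *)
Lemma nodal_shift_ge0 (a t : R) (m : nat) : a ^+ 2 = 1 -> a ^+ m = 1 -> 0 <= a * t ->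
  0 <= (nodal [seq - a / i.+2%:R | i <- iota 0 m]).[t].
Proof.
move=> a2 am at0; rewrite /nodal horner_prod big_map.
have -> : \prod_(j <- iota 0 m) ('X - (- a / j.+2%:R)%:P).[t] =
   \prod_(j <- iota 0 m) a * \prod_(j <- iota 0 m) (a * t + j.+2%:R^-1).
  rewrite -big_split; apply: eq_bigr => i _ /=.
  by rewrite hornerXsubC mulrDr mulrA -expr2 a2; ring.
rewrite big_const_seq count_predT size_iota iter_mulr_1 am mul1r.
by rewrite prodr_ge0// => i _; rewrite addr_ge0// invr_ge0.
Qed.

(* Interpolating h at tau+1 points on the far side of 0 bounds it from above near a. *)
Lemma potential_edge_fin (a : R) : a ^+ 2 = 1 -> a ^+ tau.+1 = 1 -> h a \is a fin_num.
Proof.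
move=> a2 am; have [hNoo hfin hcont hder hneg] := hok.
have aI : (-1 <= a <= 1) by nra.
have a0 : a != 0 by apply/eqP => aE; move: a2; rewrite aE; lra.
pose X := [seq - a / i.+2%:R | i <- iota 0 tau.+1].
have uX : uniq X.
  rewrite map_inj_uniq ?iota_uniq// => i j /mulfI; rewrite oppr_eq0 => /(_ a0)/invr_inj/eqP.
  by rewrite eqr_nat => /eqP[].
have XI x : x \in X -> -1 < x < 1.
  move=> /mapP[i _ ->].
  have : 0 < i.+2%:R^-1 :> R by rewrite invr_gt0.
  have : i.+2%:R^-1 < 1 :> R by rewrite invf_lt1// ltr1n.
  by move: (_^-1) => c; nra.
have [f sf fX] := lagrange_interpolation g uX.
pose Z : set R := [set x | -1 < x < 1].
have ZI x : Z x -> -1 <= x <= 1 by rewrite /Z/=; lra.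
have Zc x y : Z x -> Z y -> x < y -> {within `[x, y], continuous g}.
  by rewrite /Z/= => xI yI _; apply: potential_fin_continuous; rewrite ?hfin//; lra.
(* On the half of the interval next to a, the error is a nonpositive derivative times a nonnegative
   nodal product. *)
have gt t : -1 < t < 1 -> 0 <= a * t -> g t <= f.[t].
  move=> tI at0.
  have uX0 : uniq (X ++ [::]) by rewrite cats0.
  have sX : (size X + 2 * size ([::] : seq R) = tau.+1)%N by rewrite size_map size_iota /= muln0 addn0.
  have ZX x : x \in X ++ [::] -> Z x by rewrite cats0 => /XI.
  have sf' : (size f <= tau.+1)%N by rewrite (leq_trans sf)// size_map size_iota.
  have fX' x : x \in X ++ [::] -> f.[x] = g x by rewrite cats0 => /fX.
  have hder' j (s : R) : (j < tau.+1)%N -> -1 < s < 1 -> derivable (derive1n j g) s 1.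
    by rewrite ltnS; exact: hder.
  have [//|//|c cI] := hermite_error ZI Zc hder' (ltn0Sn _) uX0 sX ZX _ sf' fX' _ (t := t) tI.
  have := nodal_shift_ge0 a2 am at0; rewrite -/X => n0 e.
  rewrite -subr_le0 e mulr_le0_ge0//.
    by rewrite mulr_le0_ge0 ?invr_ge0//; exact: hneg.
  by rewrite mulr_ge0// sqr_ge0.
have [K K0 fK] := horner_bound f.
rewrite fin_numE hNoo//=; apply/eqP => hoo.
have aI' : `[(-1)%R, 1%R]%classic a by rewrite /= in_itv.
have hc : h @ within `[(-1)%R, 1%R] (nbhs a) --> +oo%E.
  by rewrite -hoo; have /subspace_continuousP := hcont; exact.
have /nbhs_ballP[d /= d0 dP] : \forall y \near a, `[(-1)%R, 1%R]%classic y -> (K%:E < h y)%E.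
  by have /cvgeyPgt/(_ K) := hc.
(* If h were infinite at a, it would exceed the bound K of f at y = a(1 - e). The choice e < d puts
   y in the neighbourhood, and e <= 1/2 keeps it on the side of a. *)
pose e := Num.min (d / 2) (1 / 2).
have e0 : 0 < e by rewrite lt_min !divr_gt0.
have ed : e < d by rewrite gt_min; apply/orP; left; lra.
have e2 : e <= 1 / 2 by rewrite ge_min lexx orbT.
pose y := a * (1 - e).
have aay : a * y = 1 - e by rewrite /y mulrA -expr2 a2 mul1r.
have yI : -1 < y < 1 by move: (y) aay => z; nra.
have na : `|a| = 1 by apply/eqP; rewrite -sqrp_eq1// real_normK ?num_real// a2.
have : (K%:E < h y)%E.
  apply: dP; last by rewrite /= in_itv/=; lra.
  by rewrite /ball/= /y mulrBr mulr1 opprB addrC subrK normrM na mul1r gtr0_norm.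
rewrite -(fineK (hfin _ yI)) lte_fin ltNge => /negP; apply.
apply: (le_trans (gt _ yI _)); first by rewrite aay; lra.
by rewrite (le_trans (ler_norm _))// fK//; lra.
Qed.

(** The interpolant is simple at the edges and double on D. Its error is a nonpositive derivative
    times (t-1)(t+1)^b, also nonpositive, times a square. *)
Lemma potential_minorant (D : seq R) (b : bool) : (b -> ~~ odd tau.+1) ->
  uniq (edges R b ++ D) -> (forall x, x \in D -> -1 < x < 1) ->
  (2 * size D + 1 + b = tau.+1)%N ->
  exists2 f, Ladm tau h f & forall x, x \in edges R b ++ D -> (f.[x])%:E = h x.
Proof.
move=> bev uX DI sD; have [hNoo hfin hcont hder hneg] := hok.
have Xfin x : x \in edges R b ++ D -> h x \is a fin_num.
  rewrite mem_cat /edges inE mem_nseq -orbA => /or3P[/eqP ->|/andP[b0 /eqP ->]|/DI/hfin//].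
    by apply: potential_edge_fin; rewrite expr1n.
  apply: potential_edge_fin; first by rewrite sqrrN expr1n.
  (* The point -1 is a node only when tau + 1 is even, which is what makes (-1)^(tau+1) = 1. *)
  by rewrite -signr_odd (negPf (bev _)) ?expr0//; case: (b) b0.
have [f [sf fX f'D]] := hermite_interpolation g (derive1 g) uX.
pose Z : set R := [set x | -1 <= x <= 1 /\ h x \is a fin_num].
have ZI x : Z x -> -1 <= x <= 1 by case.
have Zc x y : Z x -> Z y -> x < y -> {within `[x, y], continuous g}.
  by move=> [xI hx] [yI hy] _; apply: potential_fin_continuous => //; lra.
have XI x : x \in edges R b ++ D -> -1 <= x <= 1.
  rewrite mem_cat /edges inE mem_nseq -orbA => /or3P[/eqP ->|/andP[b0 /eqP ->]|/DI]; lra.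
have ZX x : x \in edges R b ++ D -> Z x by move=> xX; split; [exact: XI|exact: Xfin].
have sX : (size (edges R b) + 2 * size D = tau.+1)%N by rewrite /edges /= size_nseq; lia.
rewrite sX in sf.
have hder' j (s : R) : (j < tau.+1)%N -> -1 < s < 1 -> derivable (derive1n j g) s 1.
  by rewrite ltnS; exact: hder.
exists f; last by move=> x xX; rewrite fX//= fineK// Xfin.
split=> // t tI; have [ht|] := boolP (h t \is a fin_num); last first.
  by rewrite fin_numE hNoo//= negbK => /eqP ->; rewrite leey.
have [c cI e] := hermite_error ZI Zc hder' (ltn0Sn _) uX sX ZX DI sf fX f'D (conj tI ht).
rewrite -(fineK ht) lee_fin -subr_ge0 -[fine (h t)]/(g t) e.
rewrite mulr_le0// ?mulr_le0_ge0 ?invr_ge0 ?sqr_ge0//; first exact: hneg.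
rewrite /edges /nodal big_cons hornerM hornerXsubC mulr_le0_ge0//; first by lra.
case: (b); rewrite /= ?big_cons big_nil ?mulr1 ?hornerC ?hornerXsubC//; lra.
Qed.

End Potential.

(** * Zonal polynomials on the sphere *)

Section SphereMoments.
Variable R : realType.
Implicit Types (p q : {poly R}).

(* The mean of (x . y)^d over y in S^(n-1), for a unit vector x. *)
Definition sphere_moment (n d : nat) : R :=
  if odd d then 0 else \prod_(i < d./2) ((2 * i + 1)%:R / (n + 2 * i)%:R).

Lemma sphere_moment_double n e :
  sphere_moment n e.*2 = \prod_(i < e) ((2 * i + 1)%:R / (n + 2 * i)%:R).
Proof. by rewrite /sphere_moment odd_double doubleK. Qed.

(** The algebra of the induction step in [slice_moment], with indices 0 and 1 for i and i+1: [C] and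
    [c] are the binomial coefficients of 2e and e, [M] the moments, and [B] the means of the
    polynomials. *)
Lemma slice_step_identity (C1 C0 c1 c0 M1 M0 B1 B0 S I A N X Y : R) :
  N != 0 -> 2 * I * X != 0 -> 2 * I * X * C1 = 2 * A * Y * C0 ->
  I * c1 = A * c0 -> Y * B1 = N * B0 -> M1 = M0 * (X / N) ->
  C0 * M0 * B0 = c0 * S -> C1 * M1 * B1 = c1 * S.
Proof.
move=> N0 IX0 hC hc hB -> h; apply: (mulfI IX0).
transitivity (2 * I * X * C1 * (M0 * (X / N)) * B1); first by ring.
rewrite hC; transitivity (2 * A * C0 * M0 * X / N * (Y * B1)); first by ring.
rewrite hB; transitivity (2 * A * X * (C0 * M0 * B0)); first by field.
rewrite h; transitivity (2 * X * S * (A * c0)); first by ring.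
by rewrite -hc; ring.
Qed.

Section Recurrences.
Variable n : nat.
Hypothesis n2 : (2 <= n)%N.
Local Notation L := (@f0coef R n).

Lemma mul_one_minus_deriv i :
  (1 - 'X^2) * ((1 - 'X^2 : {poly R}) ^+ i)^`() = - (2 * i)%:R *: ('X * (1 - 'X^2) ^+ i).
Proof.
rewrite deriv_exp derivB derivC derivXn sub0r -mulrnAr mulrCA mul_exp_pred /= expr1.
by rewrite -mulr_natr natrM -mul_polyC polyCN polyCM !polyC_natr; ring.
Qed.

Lemma split_one_minus (A B Y Z : {poly R}) :
  (1 - 'X^2) * (A * Y + B * Z) = (1 - 'X^2) * A * Y + B * ((1 - 'X^2) * Z).
Proof. ring. Qed.

Lemma f0coef_XM_even a i :
  (2 * a + 1)%:R * L ('X^(a.*2) * (1 - 'X^2) ^+ i.+1) =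
  (n.-1 + 2 * i)%:R * L ('X^(a.+1.*2) * (1 - 'X^2) ^+ i).
Proof.
apply/eqP; rewrite -subr_eq0 -!f0coefZ// -f0coefB//; apply/eqP.
rewrite -[RHS](f0coef_ibp n2 ('X^(a.*2.+1) * (1 - 'X^2) ^+ i)); congr L.
rewrite derivM derivXn /= exprS.
rewrite split_one_minus mul_one_minus_deriv -!mul_polyC doubleS !exprS polyCN !polyC_natr.
have -> : 'X^(a.*2) *+ a.*2.+1 = (2 * a + 1)%:R * 'X^(a.*2) :> {poly R}.
  by rewrite mulr_natl mul2n addn1.
rewrite (natrD _ n.-1); ring.
Qed.

(** The recurrence from integration by parts takes the place of the symmetry t -> -t. *)
Lemma f0coef_XM_odd a i : L ('X^(a.*2.+1) * (1 - 'X^2) ^+ i) = 0.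
Proof.
elim: a i => [|a IH] i; have ni : (n.-1 + 2 * i)%:R != 0 :> R
  by rewrite pnatr_eq0; lia.
- apply: (mulfI ni); rewrite mulr0 -f0coefZ//.
  rewrite -[RHS]oppr0 -(f0coef_ibp n2 ((1 - 'X^2) ^+ i)) -f0coefN//; congr L.
  rewrite mul_one_minus_deriv -!mul_polyC polyCN !polyC_natr natrD expr1; ring.
apply: (mulfI ni); rewrite mulr0 -f0coefZ//.
have : L (a.+1.*2%:R *: ('X^(a.*2.+1) * (1 - 'X^2) ^+ i.+1) -
    (n.-1 + 2 * i)%:R *: ('X^(a.+1.*2.+1) * (1 - 'X^2) ^+ i)) = 0.
  rewrite -[RHS](f0coef_ibp n2 ('X^(a.+1.*2) * (1 - 'X^2) ^+ i)); congr L.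
  rewrite derivM derivXn /= split_one_minus mul_one_minus_deriv -!mul_polyC.
  rewrite polyCN !polyC_natr natrD doubleS !exprS -[_ *+ _]mulr_natl; ring.
by rewrite f0coefB// [L (_ *: ('X^(a.*2.+1) * _))]f0coefZ// IH mulr0 sub0r => /eqP; rewrite oppr_eq0 => /eqP.
Qed.

Lemma f0coef_X_even e : L 'X^(e.*2) = sphere_moment n e.*2.
Proof.
rewrite sphere_moment_double; elim: e => [|e IH].
  by rewrite big_ord0 expr0 f0coef1.
rewrite big_ord_recr /= -IH.
(* The recurrence now reads (2e+1)(L X^(2e) - L X^(2e+2)) = (n-1) L X^(2e+2), which is solved for L
   X^(2e+2). *)
have := f0coef_XM_even e 0; rewrite expr0 expr1 mulr1 muln0 addn0.
have -> : 'X^(e.*2) * (1 - 'X^2) = 'X^(e.*2) - 'X^(e.+1.*2) :> {poly R}.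
  by rewrite doubleS !exprS; ring.
rewrite f0coefB//; have nn : (n%:R : R) = n.-1%:R + 1 by rewrite natr1 prednK//; lia.
move=> h; have ne : (n + 2 * e)%:R != 0 :> R by rewrite pnatr_eq0; lia.
move: h; rewrite mulrBr => /eqP; rewrite subr_eq -mulrDl => /eqP h.
rewrite mulrA [L _ * _]mulrC h -mulrA [L _ / _]mulrC mulrA.
suff -> : n.-1%:R + (2 * e + 1)%:R = (n + 2 * e)%:R :> R by rewrite divff// mul1r.
by rewrite !natrD nn; ring.
Qed.

Lemma f0coef_X d : L 'X^d = sphere_moment n d.
Proof.
have [od|ed] := boolP (odd d).
  have -> : d = d./2.*2.+1 by rewrite -[LHS]odd_double_half od.
  by rewrite -['X^_]mulr1 -(expr0 (1 - 'X^2)) f0coef_XM_odd /sphere_moment /= odd_double.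
have -> : d = d./2.*2 by rewrite -[LHS]odd_double_half (negPf ed).
exact: f0coef_X_even.
Qed.

(* Slicing the mean of (x . y)^(2e) along the first coordinate of x = (x0, x') turns it,
   by this identity, into the binomial expansion of (x0^2 + |x'|^2)^e. *)
Lemma slice_moment e i : (i <= e)%N ->
  'C(e.*2, i.*2)%:R * sphere_moment n.-1 i.*2 * L ('X^((e - i).*2) * (1 - 'X^2) ^+ i) =
  'C(e, i)%:R * sphere_moment n e.*2.
Proof.
elim: i => [|i IH] ie.
  by rewrite !bin0 subn0 expr0 mulr1 f0coef_X_even !sphere_moment_double big_ord0; ring.
have {}IH := IH (ltnW ie).
have eiE : (e - i)%N = (e - i.+1).+1 by lia.
rewrite eiE in IH; set a := (e - i.+1)%N in IH *.
have rec := f0coef_XM_even a i.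
have c1 : (i.*2.+2%:R * i.*2.+1%:R) * 'C(e.*2, i.+1.*2)%:R =
   (a.*2.+2%:R * a.*2.+1%:R) * 'C(e.*2, i.*2)%:R :> R.
  rewrite -!natrM; congr _%:R; rewrite doubleS -mulnA mulnCA mul_bin_left.
  rewrite mulnCA mul_bin_left mulnA [(_ * (_ - _))%N]mulnC.
  by congr (_ * _ * _)%N; rewrite /a; lia.
have c2 : i.+1%:R * 'C(e, i.+1)%:R = a.+1%:R * 'C(e, i)%:R :> R.
  by rewrite -!natrM mul_bin_left eiE.
have s1 : sphere_moment n.-1 i.+1.*2 = sphere_moment n.-1 i.*2 * ((2 * i + 1)%:R / (n.-1 + 2 * i)%:R).
  by rewrite !sphere_moment_double big_ord_recr.
have n0 : (n.-1 + 2 * i)%:R != 0 :> R by rewrite pnatr_eq0; lia.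
have dS1 (j : nat) : j.*2.+1%:R = (2 * j + 1)%:R :> R by rewrite mul2n addn1.
have dS2 (j : nat) : j.*2.+2%:R = 2 * j.+1%:R :> R by rewrite -doubleS -mul2n natrM.
rewrite !dS1 !dS2 in c1.
have i1 : 2 * i.+1%:R * (2 * i + 1)%:R != 0 :> R by rewrite -!natrM pnatr_eq0 addn1.
exact: (slice_step_identity n0 i1 c1 c2 rec s1 IH).
Qed.

End Recurrences.

(** The expected mean of p(x . y) over the unit sphere of R^M, with r = |x|^2. Halving d is
    harmless, because odd moments vanish. *)
Definition moment_eval (M : nat) (r : R) p : R :=
  \sum_(d < size p) p`_d * (sphere_moment M d * r ^+ d./2).

Lemma moment_eval_widen M r p N : (size p <= N)%N ->
  moment_eval M r p = \sum_(d < N) p`_d * (sphere_moment M d * r ^+ d./2).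
Proof.
move=> sN; rewrite /moment_eval (big_ord_widen N (fun d => p`_d * (sphere_moment M d * r ^+ d./2)))//.
rewrite [RHS](bigID (fun d : 'I_N => (d < size p)%N)) /= [X in _ + X]big1 ?addr0// => d.
by rewrite -leqNgt => h; rewrite nth_default ?mul0r.
Qed.

Lemma moment_evalD M r p q : moment_eval M r (p + q) = moment_eval M r p + moment_eval M r q.
Proof.
have h := size_polyD p q.
rewrite (moment_eval_widen M r h) (moment_eval_widen M r (leq_maxl (size p) (size q))).
rewrite (moment_eval_widen M r (leq_maxr (size p) (size q))) -big_split.
by apply: eq_bigr => d _; rewrite coefD mulrDl.
Qed.

Lemma moment_eval_sum M r (I : Type) (s : seq I) (F : I -> {poly R}) :
  moment_eval M r (\sum_(i <- s) F i) = \sum_(i <- s) moment_eval M r (F i).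
Proof.
apply: big_morph; first exact: moment_evalD.
by rewrite /moment_eval size_poly0 big_ord0.
Qed.

Lemma moment_eval_monom M r c d : moment_eval M r (c *: 'X^d) = c * (sphere_moment M d * r ^+ d./2).
Proof.
have h : (size (c *: 'X^d : {poly R}) <= d.+1)%N.
  by rewrite (leq_trans (size_scale_leq _ _))// size_polyXn.
rewrite (moment_eval_widen M r h) big_ord_recr /= big1 ?add0r.
  by rewrite coefZ coefXn eqxx mulr1.
by move=> i _; rewrite coefZ coefXn lt_eqF ?mulr0 ?mul0r//; exact: ltn_ord.
Qed.

(** With x a function on [nat], dropping the first coordinate in the slicing recursion is a shift of
    the index. *)
Definition coord_dot (m : nat) (x : nat -> R) (s : seq R) : R := \sum_(i < m.+1) x i * s`_i.

Lemma sum_even_ord e (F : nat -> R) : (forall i, odd i -> F i = 0) ->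
  \sum_(j < e.*2.+1) F j = \sum_(i < e.+1) F i.*2.
Proof.
move=> Fo; elim: e => [|e IH]; first by rewrite !big_ord_recr !big_ord0.
rewrite [RHS]big_ord_recr /= -IH doubleS big_ord_recr /=; congr (_ + _).
by rewrite big_ord_recr /= (Fo e.*2.+1) ?addr0//= odd_double.
Qed.

Lemma eq_wint n (f f' : R -> R) : (forall t, -1 <= t <= 1 -> f t = f' t) -> wint n f = wint n f'.
Proof.
move=> ff; rewrite /wint; congr fine; apply: eq_integral => t.
by rewrite inE /= in_itv/= => /ff ->.
Qed.

(** Induction on the dimension: the induction hypothesis for the tail of x evaluates the inner mean
    at height t, and [slice_moment] then reassembles x0^2 + |x'|^2 from the binomial expansion. *)
Lemma savg_dot m (x : nat -> R) q :
  savg m (fun s => q.[coord_dot m x s]) =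
  moment_eval m.+1 (\sum_(i < m.+1) x i ^+ 2) q.
Proof.
elim: m x q => [|m IH] x q.
  rewrite /= /coord_dot !big_ord_recl !big_ord0 /= !addr0 mulr1 mulrN1.
  rewrite !horner_coef -big_split mulr_suml; apply: eq_bigr => d _ /=.
  have [od|ed] := boolP (odd d).
    by rewrite /sphere_moment od mul0r mulr0 exprNn -signr_odd od expr1; ring.
  have -> : (d : nat) = d./2.*2 by rewrite -[LHS]odd_double_half (negPf ed).
  rewrite sphere_moment_double big1 => [|i _]; last first.
    by rewrite addnC divff// pnatr_eq0.
  by rewrite -mul2n !exprM sqrrN mul2n doubleK; field.
set r := \sum_(i < m.+1) x i.+1 ^+ 2.
(* [Q] is the inner mean as a polynomial in t. Only even j survive, so the powers of sqrt(1 - t^2)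
   become powers of 1 - t^2. *)
pose Q : {poly R} := \sum_(d < size q) q`_d *: \sum_(j < d.+1)
   ('C(d, j)%:R * x 0%N ^+ (d - j) * (sphere_moment m.+1 j * r ^+ j./2)) *:
     ('X^(d - j) * (1 - 'X^2) ^+ j./2).
transitivity (f0coef m.+2 Q).
  rewrite [LHS]/= /f0coef; congr (_ * _); apply: eq_wint => t tI.
  set c := Num.sqrt (1 - t ^+ 2).
  have -> : (fun y : seq R => q.[coord_dot m.+1 x (t :: [seq c * c0 | c0 <- y])]) =
     (fun y : seq R => (q \Po ((x 0%N * t)%:P + c *: 'X)).[coord_dot m (fun i => x i.+1) y]).
    apply/funext => y; rewrite horner_comp !hornerE; congr (_.[_]).
    rewrite /coord_dot big_ord_recl /=; congr (_ + _).
    rewrite mulr_sumr; apply: eq_bigr => i _ /=.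
    have [iy|iy] := ltnP i (size y); first by rewrite (nth_map 0)// mulrCA.
    by rewrite !nth_default ?size_map// !mulr0.
  rewrite IH -/r comp_polyE moment_eval_sum /Q horner_sum; apply: eq_bigr => d _.
  rewrite exprDn scaler_sumr moment_eval_sum hornerZ horner_sum mulr_sumr.
  apply: eq_bigr => j _.
  have -> : q`_d *: ((x 0%N * t)%:P ^+ (d - j) * (c *: 'X) ^+ j *+ 'C(d, j)) =
     (q`_d * ('C(d, j)%:R * (x 0%N * t) ^+ (d - j) * c ^+ j)) *: 'X^j :> {poly R}.
    rewrite -[_ *+ 'C(d, j)]mulr_natl exprZn -!mul_polyC !polyCM !polyC_exp polyC_natr polyCM; ring.
  rewrite moment_eval_monom !(hornerZ, hornerM, horner_exp, hornerD, hornerN, hornerX, hornerC).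
  have [oj|ej] := boolP (odd j); first by rewrite /sphere_moment oj !(mul0r, mulr0).
  have cj : c ^+ j = (1 - t * t) ^+ j./2.
    have {1}-> : (j : nat) = (2 * j./2)%N by rewrite mul2n -[LHS]odd_double_half (negPf ej).
    by rewrite exprM sqr_sqrtr ?expr2//; nra.
  by rewrite cj exprMn; ring.
have slice d : \sum_(j < d.+1)
   ('C(d, j)%:R * x 0%N ^+ (d - j) * (sphere_moment m.+1 j * r ^+ j./2)) *
     f0coef m.+2 ('X^(d - j) * (1 - 'X^2) ^+ j./2) =
   sphere_moment m.+2 d * (x 0%N ^+ 2 + r) ^+ d./2.
  (* For odd d, one of j and d - j is odd, and each term vanishes by an odd moment. *)
  have [od|ed] := boolP (odd d).
    rewrite [in RHS]/sphere_moment od mul0r big1// => j _.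
    have [oj|ej] := boolP (odd j); first by rewrite /sphere_moment oj !(mul0r, mulr0).
    have odj : odd (d - j) by rewrite oddB ?od ?(negPf ej)// -ltnS.
    have -> : (d - j)%N = (d - j)./2.*2.+1 by rewrite -[LHS]odd_double_half odj.
    by rewrite f0coef_XM_odd ?mulr0.
  have dE : d = d./2.*2 by rewrite -[LHS]odd_double_half (negPf ed).
  rewrite dE doubleK; move: (d./2) => e {d ed dE}.
  rewrite (@sum_even_ord e (fun j => 'C(e.*2, j)%:R * x 0%N ^+ (e.*2 - j) *
    (sphere_moment m.+1 j * r ^+ j./2) *
     f0coef m.+2 ('X^(e.*2 - j) * (1 - 'X^2) ^+ j./2))); last first.
    by move=> j oj; rewrite /sphere_moment oj mul0r mulr0 mul0r.
  rewrite exprDn mulr_sumr; apply: eq_bigr => i _.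
  have ie : (i <= e)%N by rewrite -ltnS.
  have := slice_moment (isT : (2 <= m.+2)%N) ie; rewrite /= -doubleB doubleK => h.
  rewrite -[_ *+ 'C(e, i)]mulr_natl.
  transitivity (('C(e, i)%:R * sphere_moment m.+2 e.*2) * ((x 0%N ^+ 2) ^+ (e - i) * r ^+ i)).
    by rewrite -h -exprM mul2n; ring.
  by ring.
rewrite /Q f0coef_sum// /moment_eval big_ord_recl -/r.
apply: eq_bigr => d _; rewrite f0coefZ// f0coef_sum//; congr (_ * _).
rewrite -slice; apply: eq_bigr => j _; exact: f0coefZ.
Qed.

Lemma savg_dot_unit n (x : nat -> R) q : (2 <= n)%N -> \sum_(i < n) x i ^+ 2 = 1 ->
  savg n.-1 (fun s => q.[coord_dot n.-1 x s]) = f0coef n q.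
Proof.
move=> n2 x1; rewrite savg_dot prednK ?x1; last by lia.
rewrite -[in RHS](coefK q) poly_def f0coef_sum//; apply: eq_bigr => d _.
by rewrite f0coefZ// f0coef_X// expr1n mulr1.
Qed.

End SphereMoments.

(** * Zonal polynomials averaged over a design *)

Section DesignAverage.
Variables (R : realType) (n : nat).

Definition linear_form (x : 'rV[R]_n) : mpoly.mpoly n R :=
  \sum_(i < n) x 0 i *: mpoly.mpolyX R (mpoly.mnm1 i).

(** The design condition ranges over multivariate polynomials, so y -> f(x . y) must be presented as
    one. *)
Definition zonal_mpoly (x : 'rV[R]_n) (f : {poly R}) : mpoly.mpoly n R :=
  \sum_(d < size f) f`_d *: linear_form x ^+ d.

Lemma peval_zonal x f y : peval n (zonal_mpoly x f) y = f.[dotp n x y].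
Proof.
rewrite /peval /zonal_mpoly raddf_sum horner_coef; apply: eq_bigr => d _ /=.
rewrite mpoly.mevalZ rmorphXn /=; congr (_ * _ ^+ _).
rewrite /linear_form raddf_sum; apply: eq_bigr => i _ /=.
by rewrite mpoly.mevalZ mpoly.mevalXU.
Qed.

Lemma msize_linear_form_exp x d :
  (mpoly.mmeasure (@mpoly.mdeg n) (linear_form x ^+ d) <= d.+1)%N.
Proof.
have sl : (mpoly.mmeasure (@mpoly.mdeg n) (linear_form x) <= 2)%N.
  apply: (leq_trans (mpoly.mmeasure_sum _ _ _ _)); apply/bigmax_leqP => i _.
  by rewrite (leq_trans (mpoly.mmeasureZ_le _ _ _))// mpoly.mmeasureX /= mpoly.mdeg1.
elim: d => [|d IH]; first by rewrite expr0 mpoly.mmeasure1.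
have [->|l0] := eqVneq (linear_form x) 0; first by rewrite expr0n mpoly.mmeasure0.
rewrite exprS mpoly.msizeM ?expf_neq0//.
by apply: (@leq_trans (2 + d.+1).-1) => //; rewrite -!subn1 leq_sub2r// leq_add.
Qed.

Lemma mdeg_zonal x f m : mpoly.mcoeff m (zonal_mpoly x f) <> 0 -> (mpoly.mdeg m < size f)%N.
Proof.
move=> /eqP; rewrite -mpoly.mcoeff_msupp => /mpoly.msize_mdeg_lt /leq_trans; apply.
apply: (leq_trans (mpoly.mmeasure_sum _ _ _ _)); apply/bigmax_leqP => d _.
by rewrite (leq_trans (mpoly.mmeasureZ_le _ _ _))// (leq_trans (msize_linear_form_exp _ _)).
Qed.

Lemma sphere_avg_zonal x (f : {poly R}) : (2 <= n)%N -> sphere n x ->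
  sphere_avg n (peval n (zonal_mpoly x f)) = f0coef n f.
Proof.
move=> n2 sx; pose xs i := if insub i is Some j then x 0 j else 0.
have xsE (i : 'I_n) : xs i = x 0 i by rewrite /xs valK.
rewrite -(@savg_dot_unit R n xs)//; last first.
  by rewrite -[RHS]sx /dotp; apply: eq_bigr => i _; rewrite xsE expr2.
congr savg; apply/funext => s; rewrite peval_zonal; congr (_.[_]).
rewrite /dotp /coord_dot (eq_bigr (fun i : 'I_n => xs i * s`_i)); last first.
  by move=> i _; rewrite mxE xsE.
by rewrite prednK//; lia.
Qed.

Lemma design_sum tau N C x (f : {poly R}) : (2 <= n)%N -> (1 <= N)%N ->
  design n tau N C -> sphere n x -> (size f <= tau.+1)%N ->
  \sum_(y <- C) f.[dotp n x y] = N%:R * f0coef n f.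
Proof.
move=> n2 N1 [[_ sC _] dC] sx sf.
have := dC (zonal_mpoly x f); rewrite sphere_avg_zonal// sC => <-.
  rewrite mulrC divfK ?pnatr_eq0 -?lt0n//.
  by apply: eq_bigr => y _; rewrite peval_zonal.
by move=> m /mdeg_zonal h; rewrite -ltnS (leq_trans h).
Qed.

(** Expand |x + e y|^2 >= 0 for e = 1 and e = -1. *)
Lemma dotp_sphere_bound (x y : 'rV[R]_n) : sphere n x -> sphere n y -> -1 <= dotp n x y <= 1.
Proof.
rewrite /sphere /= => xx yy.
have h (e : R) : e ^+ 2 = 1 -> 0 <= 2 + 2 * e * dotp n x y.
  move=> e2; have : 0 <= \sum_(i < n) (x 0 i + e * y 0 i) ^+ 2.
    by apply: sumr_ge0 => i _; exact: sqr_ge0.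
  rewrite (eq_bigr (fun i => x 0 i * x 0 i + y 0 i * y 0 i + 2 * e * (x 0 i * y 0 i))).
    by rewrite !big_split /= -mulr_sumr -/(dotp n x y) -/(dotp n x x) -/(dotp n y y) xx yy.
  move=> i _; rewrite sqrrD exprMn e2; ring.
have := h 1; have := h (-1); rewrite sqrrN expr1n => /(_ erefl) ? /(_ erefl) ?; lra.
Qed.

End DesignAverage.

(** * The two node families in a common form *)

Section NodesAsSequence.
Variables (R : realType) (n k : nat) (eps : bool) (al : nat -> R).
Hypothesis keps : (0 < k + eps)%N.
Hypothesis alP : nodes n k eps al.

Let d := if eps then k else k.-1.
Let D : seq R := [seq al i | i <- iota 1 d].

(** Both values of [eps] are brought to the hypotheses of the quadrature section; a permutation is
    needed because 1 comes last in [idx] but first in [edges]. *)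
Lemma nodes_roots :
  [/\ size D = d, uniq D,
      forall t, root (jacobi n (size D) 1 (~~ eps)) t <-> t \in D &
      perm_eq [seq al i | i <- idx k eps] (edges R (~~ eps) ++ D)].
Proof.
have sD : size D = d by rewrite size_map size_iota.
have incr : incr_on R al 1 d by move: alP; rewrite /nodes /d; case: eps => [[]|[]].
split=> //.
- rewrite map_inj_in_uniq ?iota_uniq// => i j; rewrite !mem_iota => iI jI e.
  have [ij|ij|//] := ltngtP i j.
    by have := incr i j; rewrite e ltxx => /(_ _ ij); lia.
  by have := incr j i; rewrite e ltxx => /(_ _ ij); lia.
- move=> t; rewrite sD; have -> : root (jacobi n d 1 (~~ eps)) t <->
      exists2 i, (1 <= i <= d)%N & t = al i.
    by move: alP; rewrite /nodes /d; case: eps => [[_ _]|[_ _ _]]; exact.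
  split=> [[i iI ->]|/mapP[i]]; first by apply: map_f; rewrite mem_iota; lia.
  by rewrite mem_iota => iI ->; exists i => //; lia.
rewrite /idx /D /d; move: alP keps; rewrite /nodes; case: eps; rewrite [nat_of_bool _]/=.
  move=> [a1 _ _] _; have -> : iota 1 k.+1 = iota 1 k ++ [:: k.+1] by rewrite -[X in iota 1 X]addn1 iotaD.
  by rewrite map_cat /= a1; apply/permP => a; rewrite /= count_cat /= addn0 addnC.
move=> [a0 ak _ _]; case: k ak => // k' ak _.
have -> : iota 0 k'.+2 = 0%N :: iota 1 k' ++ [:: k'.+1] by rewrite -[k'.+2]addn1 iotaD add0n.
rewrite /= map_cat /= a0 ak.
by apply/permP => a; rewrite /= count_cat /= addn0 addnA addnC.
Qed.

End NodesAsSequence.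

(** * The universal bounds *)

Unset Implicit Arguments.

Theorem theorem3p7 (R : realType) (n N tau k : nat) (eps : bool)
  (h : R -> \bar R) (al : nat -> R) :
  (2 <= n)%N -> (1 <= N)%N ->
  tau.+1 = (k.*2 + eps)%N ->
  (exists C : seq 'rV[R]_n, design n tau N C) ->
  potential_ok tau h ->
  nodes n k eps al ->
  let I := idx k eps in
  let rho := fun i => gam R n * wint n (fun t => (lagr al I i).[t]) in
  let bound := ((N%:R)%:E * (\sum_(i <- I) ((rho i)%:E * h (al i)))%E)%E in
  [/\ (forall i, i \in I -> 0 < rho i),
      \sum_(i <- I) rho i = 1,
      (bound <= Qopt n tau N h)%E,
      (bound <= Ropt n tau N h)%E &
      (exists2 f, Ladm tau h f & ((N%:R * f0coef n f)%:E = bound)%E) /\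
      (forall f, Ladm tau h f -> ((N%:R * f0coef n f)%:E <= bound)%E)].

Proof.
move=> n2 N1 htau [C0 dC0] hok hal I rho bound.
have keps : (0 < k + eps)%N by move: htau; case: (eps) => /=; lia.
have [sD uD rD pI] := nodes_roots keps hal.
set D := [seq al i | i <- iota 1 _] in sD uD rD pI.
have szD : (2 * size D + 1 + ~~ eps = tau.+1)%N.
  by rewrite sD htau; move: keps; case: (eps) => /=; lia.
have even_tau : ~~ eps -> ~~ odd tau.+1.
  by rewrite htau oddD odd_double; case: (eps).
have [f fL fh] := potential_minorant hok even_tau (uniq_nodes n2 uD rD)
  (fun x => nodal_interior n2 uD rD (x := x)) szD.
have alX i : i \in I -> al i \in edges R (~~ eps) ++ D.
  by move=> iI; rewrite -(perm_mem pI) map_f.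
have quad (q : {poly R}) : (size q <= tau.+1)%N -> f0coef n q = \sum_(i <- I) rho i * q.[al i].
  by rewrite -szD => sq; exact: (quadrature n2 uD rD pI).
have rho_gt0 i : i \in I -> 0 < rho i by exact: (quadrature_weight_gt0 n2 uD rD pI).
(* Quadrature is exact for f, and f agrees with h at the nodes. *)
have boundE : bound = (N%:R * f0coef n f)%:E.
  rewrite /bound EFinM; congr (_ * _)%E; rewrite quad; last by case: fL.
  rewrite -sumEFin big_seq [RHS]big_seq; apply: eq_bigr => i iI.
  by rewrite -fh ?alX.
(* This bound at every point of the sphere and for every design serves both extremal problems. *)
have boundU C x : design n tau N C -> sphere n x -> (bound <= Uh n h x C)%E.
  move=> dC sx; have [sf fle] := fL.
  rewrite boundE -(design_sum n2 N1 dC sx sf) -sumEFin /Uh big_seq [leRHS]big_seq.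
  apply: lee_sum => y yC; apply: fle; apply: dotp_sphere_bound => //.
  by have [[_ _ sC] _] := dC; exact: sC.
split.
- exact: rho_gt0.
- exact: (quadrature_weight_sum n2 uD rD pI).
- apply: (@le_trans _ _ (Qh n h C0)).
    by apply: le_ereal_inf_tmp => _ [x sx <-]; exact: boundU.
  by apply: ereal_sup_ubound; exists C0.
- apply: le_ereal_inf_tmp => _ [C dC <-].
  (* The supremum dominates its value at one point of the sphere; the code provides one, since N >=
     1. *)
  have [x xC] : exists x, x \in C.
    have [[_ sC _] _] := dC; case: C {dC} sC => [|x C _]; last by exists x; exact: mem_head.
    by move=> N0; move: N1; rewrite -N0.
  have sx : sphere n x by have [[_ _ sC] _] := dC; exact: sC.
  by apply: (le_trans (boundU C x dC sx)); apply: ereal_sup_ubound; exists x.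
split; first by exists f.
(* Quadrature is exact for q, the weights are positive, and q <= h at each node. *)
move=> q [sq qh]; rewrite /bound EFinM lee_pmul2l//; last by rewrite lte_fin ltr0n.
rewrite quad// -sumEFin big_seq [leRHS]big_seq; apply: lee_sum => i iI.
rewrite EFinM lee_pmul2l ?lte_fin ?rho_gt0//; apply: qh.
have := alX i iI; rewrite mem_cat /edges inE mem_nseq -orbA.
move=> /or3P[/eqP ->|/andP[_ /eqP ->]|/(nodal_interior n2 uD rD)]; lra.
Qed.
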